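(* Let $q\ge 2$ be the number of stages, let $\mathbf n=(n,n)$, and let $Z_\tau=\tau M^{-1}K$, with $M$ and $K$ symmetric positive definite mass and stiffness matrices. Let $\mathcal P_L^{-1}\mathcal A$ be the preconditioned matrix defined in the context. Assume that $\{Z_\tau\}_{\mathbf n}\sim_\lambda s$, i.e. the matrix-sequence $\{Z_\tau\}_{\mathbf n}$ is spectrally distributed as the measurable function $s$. Then the preconditioned matrix-sequence $\{\mathcal P_L^{-1}\mathcal A\}$ enjoys the relation $$\{\mathcal P_L^{-1}\mathcal A\}\sim_\lambda \mathbf t_s,\qquad \mathbf t_s=\mathrm{diag}\left(1,\,1+\lambda_1(f(s)),\,\ldots,\,1+\lambda_{q-1}(f(s))\right).$$ Here: - if $q=2$, $\lambda_1(f)=f$ with $f(\mu)=-\left(4\mu^{-1}+\frac23\mu+\frac{11}{3}\right)^{-1}$; - if $q=3$, $\lambda_1(f(\mu)),\lambda_2(f(\mu))$ are the two solutions $\lambda$ of the second degree equation displayed in the context; - if $q>3$, $\lambda_1(f(\mu)),\ldots,\lambda_{q-1}(f(\mu))$ are the $q-1$ roots of the degree $q-1$ polynomial in $\lambda$ produced by the elimination procedure described in the context.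
   Context: **Preconditioned matrix.** $A_q\in\mathbb R^{q\times q}$ is the Runge-Kutta matrix of the $q$-stage Radau IIA method: $c_1<\dots<c_q=1$ are the zeros of $\frac{d^{q-1}}{dx^{q-1}}\left(x^{q-1}(x-1)^q\right)$ and $(A_q)_{ij}=\int_0^{c_i}p_j(x)\,dx$, where $p_j$ is the Lagrange basis polynomial of degree $q-1$ with $p_j(c_k)=\delta_{jk}$. One factorizes $A_q^{-1}=L_qU_q$ with $L_q$ lower triangular and $U_q$ upper triangular with unit diagonal, and puts $\widehat U_q=U_q-I_q$ (strictly upper triangular). $M$ and $K$ are real square matrices of the same order $N=n^2$, arising from the space discretization of a time-dependent partial differential equation, and $\tau>0$ is the time step. With $\otimes$ the Kronecker product, $$\mathcal A=A_q^{-1}\otimes M+\tau I_q\otimes K,\qquad \mathcal P_L=L_q\otimes M+\tau I_q\otimes K .$$ **Branches.** Let $\hat u_{i,j}$ be the entries of $\widehat U_q$ and $\ell_{i,j}$ those of $L_q^{-1}$. The eigenvalues $\lambda$ of $\mathcal P_L^{-1}\mathcal A-I$ are determined by $$(\widehat U_q\otimes I_N)\bm v=\lambda\,(I_{qN}+L_q^{-1}\otimes Z_\tau)\bm v .$$ The letter $\mu$ denotes a generic eigenvalue of $Z_\tau$, $\mu\in(0,\infty)$; in $\mathbf t_s$ it is replaced by $s$. Case $q=3$. Set $$l_1(\lambda,\mu)=-\left[\hat u_{2,3}(1+\ell_{3,3}\mu)^{-1}\ell_{3,2}\mu+\lambda(1+\ell_{2,2}\mu)\right],$$ $$l_2(\lambda,\mu)=\hat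 u_{2,3}(1+\ell_{3,3}\mu)^{-1}\ell_{3,1}\mu+\lambda\ell_{2,1}\mu .$$ The second degree equation in $\lambda$ is $$-\lambda(1+\ell_{1,1}\mu)(1+\ell_{3,3}\mu)\,l_1(\lambda,\mu)-\hat u_{1,3}\ell_{3,2}\,\mu\, l_2(\lambda,\mu)+\hat u_{1,2}(1+\ell_{3,3}\mu)\,l_2(\lambda,\mu)=0 .$$ Case $q>3$. Write $\bm v=[\bm v_1,\ldots,\bm v_q]^T$ with $\bm v_i\in\mathbb C^N$ and take $\lambda\ne0$. The last block row gives $\bm v_q=-(I_N+\ell_{q,q}Z_\tau)^{-1}Z_\tau\sum_{j<q}\ell_{q,j}\bm v_j$, which is inserted in the other block rows. One continues in the same way, using the next block row from the bottom to express its unknown block through the remaining ones, until an equation involving only $\bm v_1$ is left. Choosing $\bm v_1$ as an eigenvector of the diagonalizable matrix $Z_\tau$ for the eigenvalue $\mu$ gives a polynomial equation in $\lambda$ of degree $q-1$ with coefficients that are real-valued rational functions of $\mu$. **Spectral distribution.** Let $\{X_{\mathbf n,r}\}_{\mathbf n}$ be a sequence of square matrices of dimensions $d_{\mathbf n}\to\infty$ as $\mathbf n\to\infty$ (all components of $\mathbf n$ tending to infinity), with $r$ independent of $\mathbf n$. Let $\bm f:D\to\mathbb C^{r\times r}$ be a Hermitian matrix-valued measurable function on a measurable set $D\subset\mathbb R^m$ with Lebesgue measure $0<\mu_m(D)<\infty$. One writes $\{X_{\mathbf n,r}\}_{\mathbf n}\sim_\lambda\bm f$, and says that the sequence is distributed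 like $\bm f$ in the sense of eigenvalues, with spectral symbol $\bm f$, if for every $F\in C_c(\mathbb R)$ (continuous with compact support) $$\lim_{\mathbf n\to\infty}\frac1{d_{\mathbf n}}\sum_{k=1}^{d_{\mathbf n}}F(\lambda_k(X_{\mathbf n,r}))=\frac1{\mu_m(D)}\int_D\frac1r\sum_{k=1}^rF(\lambda_k(\bm f(\bm\theta)))\,d\mu_m(\bm\theta),$$ where in this formula $\lambda_k(\cdot)$ denotes the eigenvalues of the indicated matrix. The relation $\sim_\lambda$ in the claim is this one, with $r=1$ for the scalar function $s$ and $r=q$ for $\mathbf t_s$.
   Formalization: For q=3 the displayed equation lacks the term -û_{1,3} ℓ_{3,1} μ l_1, which is restored; as the roots may be complex, test functions F are continuous with compact support on C and t_s need not be Hermitian; measurable means Borel; branches are set to 0 where s is not positive. *)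

(* Defs.v *)
From HB Require Import structures.
From mathcomp Require Import all_boot all_order all_algebra.
From mathcomp Require Import complex mxtens.
From mathcomp Require Import all_classical all_reals all_analysis.

Set Implicit Arguments.
Unset Strict Implicit.
Unset Printing Implicit Defensive.

Import Order.TTheory GRing.Theory Num.Theory.
Import numFieldNormedType.Exports.

Local Open Scope classical_set_scope.
Local Open Scope ring_scope.
Local Open Scope complex_scope.

(* Lebesgue measure on R^m (m.-tuple R with the product sigma-algebra), by
   recursion on m: the image of the product measure under (x, t) |-> x :: t. *)
Section LebesgueMeasureRm.
Context {R : realType}.

Let T := measurableTypeR R.

Definition consRm m (xt : T * m.-tuple T) : m.+1.-tuple T :=
  [the m.+1.-tuple T of xt.1 :: xt.2].

Definition unconsRm m (t : m.+1.-tuple T) : T * m.-tuple T :=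
  (thead t, [tuple of behead t]).

Lemma measurable_consRm m : measurable_fun [set: T * m.-tuple T] (@consRm m).
Proof. exact: measurable_cons. Qed.

Lemma measurable_unconsRm m : measurable_fun [set: m.+1.-tuple T] (@unconsRm m).
Proof.
apply/measurable_fun_pair; first exact: measurable_tnth.
exact: measurable_behead.
Qed.

Lemma consRmK m : cancel (@consRm m) (@unconsRm m).
Proof. by move=> [x t]; congr pair; apply: val_inj. Qed.

Section Step.
Context (m : nat) (nu : {sigma_finite_measure set (m.-tuple T) -> \bar R}).

Definition lebesgue_step : set (m.+1.-tuple T) -> \bar R :=
  pushforward (lebesgue_measure \x nu)%E (@consRm m).

Let step0 : (lebesgue_step set0 = 0)%E.
Proof. by rewrite /lebesgue_step /pushforward preimage_set0 measure0. Qed.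

Let step_ge0 A : (0 <= lebesgue_step A)%E.
Proof. exact: (measure_ge0 (lebesgue_measure \x nu)%E). Qed.

Let step_sigma_additive : semi_sigma_additive lebesgue_step.
Proof.
move=> F mF tF mUF; rewrite /lebesgue_step /pushforward preimage_bigcup.
apply: measure_semi_sigma_additive.
- by move=> n; rewrite -[X in measurable X]setTI; exact: measurable_consRm.
- apply/trivIsetP => /= i j _ _ ij; rewrite -preimage_setI.
  by move/trivIsetP : tF => /(_ _ _ _ _ ij) ->//; rewrite preimage_set0.
- by rewrite -preimage_bigcup -[X in measurable X]setTI; exact: measurable_consRm.
Qed.

HB.instance Definition _ := isMeasure.Build _ _ _ lebesgue_step
  step0 step_ge0 step_sigma_additive.

Let step_sigma_finite : sigma_finite setT lebesgue_step.
Proof.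
have /sigma_finiteP[F [FT Fnd Foo]] := sigma_finiteT (@lebesgue_measure R).
have /sigma_finiteP[G [GT Gnd Goo]] := sigma_finiteT nu.
exists (fun n => @unconsRm m @^-1` (F n `*` G n)).
  rewrite -preimage_bigcup (_ : \bigcup_i _ = setT) ?preimage_setT//.
  apply/seteqP; split=> // -[x y] _.
  have : setT x by []. rewrite FT => -[i _ Fix].
  have : setT y by []. rewrite GT => -[j _ Gjy].
  exists (maxn i j) => //; split => /=.
    by move: x Fix; exact/subsetPset/Fnd/leq_maxl.
  by move: y Gjy; exact/subsetPset/Gnd/leq_maxr.
move=> n; have [mF Fnoo] := Foo n; have [mG Gnoo] := Goo n.
split.
  rewrite -[X in measurable X]setTI; apply: measurable_unconsRm => //.
  exact: measurableX.
rewrite /lebesgue_step /pushforward -comp_preimage.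
rewrite (_ : _ \o _ = id) ?preimage_id.
  by rewrite product_measure1E// lte_mul_pinfty// ge0_fin_numE.
by apply/funext => x /=; rewrite consRmK.
Qed.

HB.instance Definition _ := Measure_isSigmaFinite.Build _ _ _ lebesgue_step
  step_sigma_finite.

End Step.

Fixpoint lebesgueRm m : {sigma_finite_measure set (m.-tuple T) -> \bar R} :=
  match m with
  | 0%N => [the {sigma_finite_measure set (0.-tuple T) -> \bar R} of
           \d_([tuple] : 0.-tuple T)]
  | m'.+1 => [the {sigma_finite_measure set (m'.+1.-tuple T) -> \bar R} of
             lebesgue_step (lebesgueRm m')]
  end.

End LebesgueMeasureRm.

Section Spectrum.
Context {R : realType}.

Definition complex_mx n (A : 'M[R]_n) : 'M[R[i]]_n := map_mx (real_complex R) A.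

(* All the eigenvalues, repeated according to algebraic multiplicity. *)
Definition eigenvalues n (A : 'M[R[i]]_n) : seq R[i] :=
  sval (closed_field_poly_normal (char_poly A)).

(* {X_n} ~_lambda f on D.  The test functions are compactly supported on the
   complex plane: the matrices need not be symmetric and the spectra are complex
   in general; on real spectra this is the same as testing on R.  Real-valued
   test functions suffice by linearity.  The eigenvalues of a matrix carry no
   canonical labelling, so the measurability of f is required through the
   symmetric functions of its eigenvalues that are integrated. *)
Definition spectrally_distributed (m : nat) (D : set (m.-tuple (measurableTypeR R)))
    (d : nat -> nat) (X : forall n, 'M[R[i]]_(d n))
    (r : nat) (f : m.-tuple (measurableTypeR R) -> 'M[R[i]]_r) : Prop :=
  forall F : R[i]^o -> R^o,
    continuous F -> compact (closure [set z | F z != 0]) ->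
    measurable_fun D (fun x => \sum_(z <- eigenvalues (f x)) F z) /\
    (fun n => (d n)%:R^-1 * \sum_(z <- eigenvalues (X n)) F z) @ \oo -->
      (fine (lebesgueRm m D))^-1 *
      \int[lebesgueRm m]_(x in D) (r%:R^-1 * \sum_(z <- eigenvalues (f x)) F z).

Definition sym_posdef n (A : 'M[R]_n) : Prop :=
  A^T = A /\ forall x : 'cV[R]_n, x != 0 -> 0 < (x^T *m A *m x) 0 0.

End Spectrum.

Section RadauIIA.
Context {R : realType}.

Definition radau_poly q : {poly R} := ('X^(q.-1) * ('X - 1) ^+ q)^`(q.-1).

Definition radau_nodes q (c : 'I_q.+1 -> R) : Prop :=
  [/\ forall i j : 'I_q.+1, (i < j)%N -> c i < c j,
      c ord_max = 1
    & forall x, root (radau_poly q.+1) x <-> exists i, c i = x].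

Definition lagrange_poly q (c : 'I_q -> R) (j : 'I_q) : {poly R} :=
  let w := \prod_(k | k != j) ('X - (c k)%:P) in w.[c j]^-1 *: w.

Definition radau_mx q (c : 'I_q -> R) : 'M[R]_q :=
  \matrix_(i, j) \int[lebesgue_measure]_(x in `[0, c i]) (lagrange_poly c j).[x].

Definition LU_factorization q (A L U : 'M[R]_q) : Prop :=
  [/\ is_trig_mx L,
      forall i j : 'I_q, (j < i)%N -> U i j = 0,
      forall i, U i i = 1
    & A = L *m U].

Definition stage_mx q (Aq : 'M[R]_q) N (M K : 'M[R]_N) (tau : R) : 'M[R]_(q * N) :=
  tensmx (invmx Aq) M + tau *: tensmx 1%:M K.

Definition precond_mx q (L : 'M[R]_q) N (M K : 'M[R]_N) (tau : R) : 'M[R]_(q * N) :=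
  tensmx L M + tau *: tensmx 1%:M K.

Definition Ztau N (M K : 'M[R]_N) (tau : R) : 'M[R]_N := tau *: (invmx M *m K).

End RadauIIA.

(* Backward substitution in S v = 0: the last row gives v_k in terms of
   v_0, ..., v_(k-1), and v_k is replaced in the other rows. *)
Definition substitute_last (F : fieldType) k (S : 'M[F]_k.+2) : 'M[F]_k.+1 :=
  let w := widen_ord (leqnSn k.+1) in
  \matrix_(i, j) (S (w i) (w j)
                  - S (w i) ord_max * (S ord_max ord_max)^-1 * S ord_max (w j)).

(* The coefficient of v_0 in the last remaining equation, multiplied by all the
   pivots by which the substitutions divided (clearing denominators). *)
Fixpoint eliminate (F : fieldType) k : 'M[F]_k.+1 -> F :=
  match k with
  | 0%N => fun S => S ord0 ord0
  | k'.+1 => fun S => S ord_max ord_max * eliminate (substitute_last S)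
  end.

Section Branches.
Context {R : realType}.

Definition branch_q2 (mu : R) : R := - (4 * mu^-1 + 2 / 3 * mu + 11 / 3)^-1.

Section QuadraticEquation.
Context (Uh Li : 'M[R]_3) (mu : R).

Let u (i j : nat) : R := Uh (inord i.-1) (inord j.-1).
Let l (i j : nat) : R := Li (inord i.-1) (inord j.-1).

(* Below, 'X stands for lambda and the indices of u and l start at 1. *)
Definition l1_q3 : {poly R} :=
  - ((u 2 3 * (1 + l 3 3 * mu)^-1 * l 3 2 * mu)%:P + (1 + l 2 2 * mu) *: 'X).

Definition l2_q3 : {poly R} :=
  (u 2 3 * (1 + l 3 3 * mu)^-1 * l 3 1 * mu)%:P + (l 2 1 * mu) *: 'X.

(* The last summand is the contribution of v_1 when
   v_3 = - (1 + l_33 mu)^-1 mu (l_31 v_1 + l_32 v_2) is inserted in the first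
   row.  It cannot be dropped: u_13 and l_31 are nonzero. *)
Definition quadratic_q3 : {poly R} :=
  - (((1 + l 1 1 * mu) * (1 + l 3 3 * mu)) *: ('X * l1_q3))
  - (u 1 3 * l 3 2 * mu) *: l2_q3
  + (u 1 2 * (1 + l 3 3 * mu)) *: l2_q3
  - (u 1 3 * l 3 1 * mu) *: l1_q3.

End QuadraticEquation.

(* The system Uh v = lambda (1 + mu Li) v, with lambda = 'X; the last row of Uh
   is zero, and the last equation is divided by - lambda (lambda <> 0). *)
Definition reduced_system q (Uh Li : 'M[R]_q.+1) (mu : R) :
    'M[{fraction {poly R}}]_q.+1 :=
  \matrix_(i, j)
    if i == ord_max then tofrac ((i == j)%:R + mu * Li i j)%:P
    else tofrac ((Uh i j)%:P - ((i == j)%:R + mu * Li i j) *: 'X).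

(* lam lists the complex roots of P with multiplicity. *)
Definition lists_roots m (P : {poly R}) (lam : 'I_m -> R[i]) : Prop :=
  let PC := map_poly (real_complex R) P in
  PC != 0 /\ PC = lead_coef PC *: \prod_k ('X - (lam k)%:P).

(* lam lists lambda_1, ..., lambda_(q-1) at mu, for q = p + 2. *)
Definition branch_values p :
    'M[R]_p.+2 -> 'M[R]_p.+2 -> R -> ('I_p.+1 -> R[i]) -> Prop :=
  match p with
  | 0%N => fun _ _ mu lam => lam ord0 = (branch_q2 mu)%:C
  | 1%N => fun Uh Li mu lam => lists_roots (quadratic_q3 Uh Li mu) lam
  | p'.+2 => fun Uh Li mu lam =>
      exists2 P : {poly R}, tofrac P = eliminate (reduced_system Uh Li mu)
                          & lists_roots P lam
  end.

(* diag (1, 1 + lambda_1, ..., 1 + lambda_(q-1)) at mu.  The branches live on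
   ]0, +oo[; they are extended by their limit 0 at 0.  A symbol of matrices with
   positive eigenvalues may vanish but is almost everywhere nonnegative. *)
Definition branch_symbol p (lam : 'I_p.+1 -> R -> R[i]) (mu : R) : 'M[R[i]]_p.+2 :=
  diag_mx (\row_k if unlift ord0 k is Some j
                  then 1 + (if 0 < mu then lam j mu else 0) else 1).

End Branches.

(* Main.v *)
(* With Z = Ztau, the preconditioned matrix is the quotient of L U (x) 1 + 1 (x) Z
   by L (x) 1 + 1 (x) Z.  Triangularizing Z shows that its spectrum is the union,
   over the eigenvalues mu of Z, of the spectra of
   (L + mu)^-1 (L U + mu) = 1 + E(mu),  E(mu) = (1 + mu L^-1)^-1 (U - 1);
   these mu are positive since M and K are positive definite.  By backward
   elimination, i.e. successive Schur complements, the eigenvalues of E(mu) are 0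
   and the branches lambda_j.  The hypothesis on the branches also says that the
   elimination polynomial has degree q - 1, which makes 1 + mu L^-1 invertible.

   Hence the sum of F over the spectrum of the preconditioned matrix is the sum
   of G over the spectrum of Z, where G(mu) is the sum of F over the spectrum of
   1 + E(mu).  The function G is continuous because the roots of a monic
   polynomial depend continuously on its coefficients, and it tends to q F(1)
   both at 0, where E is nilpotent, and at +oo, where E vanishes.  So G - q F(1),
   extended by 0 to mu <= 0, vanishes at infinity, and such functions are uniform
   limits of the compactly supported ones allowed by the hypothesis on Z. *)

Require Import Defs.
From mathcomp Require Import all_boot all_order all_algebra.
From mathcomp Require Import complex mxtens perm mxred spectral.
From mathcomp Require Import all_classical all_reals all_analysis.
From mathcomp Require Import ring lra.

Set Implicit Arguments.
Unset Strict Implicit.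
Unset Printing Implicit Defensive.

Import Order.TTheory GRing.Theory Num.Theory.
Import numFieldNormedType.Exports.

Local Open Scope classical_set_scope.
Local Open Scope ring_scope.
Local Open Scope complex_scope.

(** * Determinants of Kronecker sums *)

(** The bijection forces [m = n]; rows and columns then undergo the same permutation, and the two
    signs cancel. *)
Lemma det_reindex (R : comNzRingType) m n (f : 'I_m -> 'I_n) (M : 'M[R]_n) :
  bijective f -> \det (\matrix_(i, j) M (f i) (f j)) = \det M.
Proof.
move=> bf; have := bij_eq_card bf; rewrite !card_ord => emn.
case: _ / emn in M f bf *; have injf := bij_inj bf.
rewrite (_ : \matrix_(i, j) _ = row_perm (perm injf) (col_perm (perm injf) M)).
  rewrite row_permE col_permE !det_mulmx !det_perm odd_permV mulrCA.
  by rewrite -signr_addb addbb mulr1.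
by apply/matrixP => i j; rewrite !mxE !permE.
Qed.

(** Exchanging the two components of every index pair is a bijection carrying one Kronecker sum to
    the other. It serves to put a triangular factor first. *)
Lemma det_tens_swap (R : comNzRingType) q N (A B : 'M[R]_q) (S T : 'M[R]_N) :
  \det (A *t S + B *t T) = \det (S *t A + T *t B).
Proof.
pose f (i : 'I_(N * q)) : 'I_(q * N) :=
  let ij := mxtens_unindex i in mxtens_index (ij.2, ij.1).
pose g (i : 'I_(q * N)) : 'I_(N * q) :=
  let ij := mxtens_unindex i in mxtens_index (ij.2, ij.1).
have bf : bijective f.
  by exists g => i; rewrite /f /g mxtens_indexK -surjective_pairing mxtens_unindexK.
rewrite -(det_reindex _ bf); congr determinant; apply/matrixP => i j.
by rewrite !mxE !mxtens_indexK /= [A _ _ * _]mulrC [B _ _ * _]mulrC.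
Qed.

(** With [T] as first factor the matrix is block lower triangular with diagonal blocks
    [A + T k k *: B]; the induction peels off the first block. *)
Lemma det_tens_trig (R : comNzRingType) q N (A B : 'M[R]_q) (T : 'M[R]_N) :
  is_trig_mx T ->
  \det (A *t 1%:M + B *t T) = \prod_(k < N) \det (A + T k k *: B).
Proof.
rewrite det_tens_swap; elim: N T => [|N IH] T trigT.
  by rewrite big_ord0 det_mx00.
(* The first [q] indices form block 0; the others are the indices of the smaller Kronecker product,
   shifted by one block. *)
have uil (i : 'I_q) : mxtens_unindex (lshift (N * q) i : 'I_(N.+1 * q)) = (ord0, i).
  by congr pair; apply/val_inj; rewrite /= ?divn_small ?modn_small.
have uir (i : 'I_(N * q)) : mxtens_unindex (rshift q i : 'I_(N.+1 * q)) =
    (lift ord0 (mxtens_unindex i).1, (mxtens_unindex i).2).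
  have q0 : (0 < q)%N by move: i; case: (q) => // -[i /=]; rewrite muln0.
  by congr pair; apply/val_inj; rewrite /= ?modnDl // divnDl // divnn q0.
set W := (X in \det X); have WE i j : W i j =
    let: (i1, i2) := mxtens_unindex i in let: (j1, j2) := mxtens_unindex j in
    (i1 == j1)%:R * A i2 j2 + T i1 j1 * B i2 j2.
  by rewrite !mxE.
clearbody W; rewrite -[W](@submxK _ q (N * q) q (N * q)).
rewrite (_ : ursubmx _ = 0); last first.
  apply/matrixP => i j; rewrite !mxE WE uil uir /=.
  by rewrite (is_trig_mxP trigT) // !mul0r addr0.
rewrite det_lblock big_ord_recl; congr (\det _ * _).
  by apply/matrixP => i j; rewrite !mxE WE !uil /= mul1r.
rewrite (_ : drsubmx _ = 1%:M *t A + (@drsubmx _ 1 N 1 N T) *t B); last first.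
  by apply/matrixP => i j; rewrite !mxE WE !uir /= (inj_eq lift_inj) !rshift1.
rewrite IH; last first.
  apply/is_trig_mxP => i j ij; rewrite !mxE (is_trig_mxP trigT) //.
by apply: eq_bigr => k _; rewrite !mxE !rshift1.
Qed.

Lemma tensmx11 (R : pzRingType) q N : (1%:M : 'M[R]_q) *t (1%:M : 'M[R]_N) = 1%:M.
Proof.
apply/matrixP => i j; case: (mxtens_indexP i) (mxtens_indexP j) => i1 i2 [j1 j2].
rewrite tensmxE !mxE (can_eq (@mxtens_indexK _ _)) xpair_eqE.
by case: eqP; case: eqP; rewrite ?mulr1 ?mulr0.
Qed.

(** The factor [\det P] absorbs the inverse, so that the determinant formulas for Kronecker sums
    become applicable. *)
Lemma char_poly_pencil (F : fieldType) n (P S : 'M[F]_n) : P \in unitmx ->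
  (\det P) *: char_poly (invmx P *m S) = \det ('X *: map_mx polyC P - map_mx polyC S).
Proof.
move=> Pu; rewrite -mul_polyC -det_map_mx /char_poly -det_mulmx /char_poly_mx.
rewrite mulmxBr scalar_mxC mul_scalar_mx -map_mxM.
by rewrite mulmxA mulmxV // mul1mx.
Qed.

Lemma char_poly_conj (F : fieldType) n (P T : 'M[F]_n) : P \in unitmx ->
  char_poly (invmx P *m T *m P) = char_poly T.
Proof.
move=> Pu; have detP : \det P != 0 by rewrite -unitfE -unitmxE.
apply: (scalerI detP); rewrite -mulmxA char_poly_pencil //.
by rewrite map_mxM -mul_scalar_mx -mulmxBl det_mulmx mulrC det_map_mx mul_polyC.
Qed.

(** [Z] is triangularized over [C] by Schur's theorem and the similarity is transported by [f]. With
    [polyC] for [f], the entries of [A] and [B] may be polynomials. *)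
Lemma det_tens_eigen (C : numClosedFieldType) (R : comNzRingType)
    (f : {rmorphism C -> R}) q N (A B : 'M[R]_q) (Z : 'M[C]_N) (r : seq C) :
  char_poly Z = \prod_(z <- r) ('X - z%:P) ->
  \det (A *t 1%:M + B *t map_mx f Z) = \prod_(z <- r) \det (A + f z *: B).
Proof.
(* The Schur form is taken for positive order; at order 0 the list [r] is empty and both sides are
   1. *)
case: N Z => [|N] Z chZ.
  have /perm_size : perm_eq r [::].
    by apply: prod_XsubC_eq; rewrite big_nil -chZ /char_poly det_mx00.
  case: r chZ => // _ _; rewrite big_nil det_tens_swap.
  by rewrite (_ : _ + _ = (0 : 'M[R]_(0 * q))) ?det_mx00 //; apply/matrixP => -[].
have [P Pu trigP] := Schur Z (ltn0Sn N).
have {}Pu := unitarymx_unit Pu.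
move: trigP; rewrite /mxred.similar_to /= mxred.conjumx //.
set T := P *m Z *m invmx P => trigT.
have ZE : Z = invmx P *m T *m P by rewrite /T !mulmxA mulVmx // mul1mx mulmxKV.
have chT : char_poly Z = char_poly T.
  by rewrite ZE char_poly_conj.
have pr : perm_eq r [seq T k k | k <- enum 'I_N.+1].
  apply: prod_XsubC_eq; rewrite -chZ chT char_poly_trig // big_map.
  by rewrite big_enum.
rewrite (perm_big _ pr) big_map big_enum /=.
pose P' := map_mx f P.
have PP : P' *m map_mx f (invmx P) = 1%:M by rewrite -map_mxM mulmxV // map_mx1.
have QP : map_mx f (invmx P) *m P' = 1%:M by rewrite -map_mxM mulVmx // map_mx1.
transitivity (\det (A *t 1%:M + B *t map_mx f T)); last first.
  rewrite det_tens_trig; first by apply: eq_bigr => k _; rewrite mxE.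
  by apply/is_trig_mxP => i j ij; rewrite mxE (is_trig_mxP trigT) // rmorph0.
rewrite [LHS](_ : _ = \det ((1%:M *t map_mx f (invmx P)) *m
                      (A *t 1%:M + B *t map_mx f T) *m (1%:M *t P'))).
  rewrite !det_mulmx mulrC mulrA -det_mulmx tensmx_mul mul1mx PP.
  by rewrite (_ : 1%:M *t 1%:M = 1%:M) ?det1 ?mul1r // tensmx11.
rewrite mulmxDr mulmxDl !tensmx_mul !mul1mx !mulmx1 QP.
by rewrite [in LHS]ZE !map_mxM.
Qed.

(** * The spectrum of the preconditioned matrix *)

Lemma char_poly_tens_pencil (C : numClosedFieldType) q N (L B : 'M[C]_q)
    (Z : 'M[C]_N) (r : seq C) (P := L *t 1%:M + 1%:M *t Z) :
  char_poly Z = \prod_(z <- r) ('X - z%:P) ->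
  {in r, forall z, L + z%:M \in unitmx} ->
  P \in unitmx /\
  char_poly (invmx P *m (B *t 1%:M + 1%:M *t Z)) =
    \prod_(z <- r) char_poly (invmx (L + z%:M) *m (B + z%:M)).
Proof.
move=> chZ Lu.
have detP : \det P = \prod_(z <- r) \det (L + z%:M).
  have idZ : map_mx (idfun : {rmorphism C -> C}) Z = Z by rewrite map_mx_id.
  have := det_tens_eigen (idfun : {rmorphism C -> C}) L 1%:M chZ.
  rewrite idZ => ->.
  by apply: eq_bigr => z _; rewrite scalemx1.
have Pu : P \in unitmx.
  rewrite unitmxE unitfE detP prodf_seq_neq0; apply/allP => z zr /=.
  by rewrite -unitfE -unitmxE Lu.
have detP0 : \det P != 0 by rewrite -unitfE -unitmxE.
split=> //; apply: (scalerI detP0); rewrite char_poly_pencil //.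
rewrite [in RHS]detP -scaler_prod.
rewrite /P !map_mxD !map_mxT !map_mx1.
(* The pencil is again a Kronecker sum, to which [det_tens_eigen] applies with [polyC]. *)
have -> (a b : 'M[{poly C}]_q) (Z' : 'M[{poly C}]_N) :
    'X *: (a *t 1%:M + 1%:M *t Z') - (b *t 1%:M + 1%:M *t Z') =
    ('X *: a - b) *t 1%:M + (('X - 1) *: 1%:M) *t Z'.
  by apply/matrixP => i j; rewrite !mxE; ring.
rewrite (det_tens_eigen _ _ _ chZ) [LHS]big_seq [RHS]big_seq.
apply: eq_bigr => z zr; rewrite char_poly_pencil ?Lu //.
congr (\det _); rewrite !map_mxD !map_scalar_mx /=.
by apply/matrixP => i j; rewrite !mxE; case: eqP => _ /=; ring.
Qed.

Section Eigenvalues.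
Context {R : realType}.

Lemma char_poly_eigenvalues n (M : 'M[R[i]]_n) :
  char_poly M = \prod_(z <- eigenvalues M) ('X - z%:P).
Proof.
rewrite /eigenvalues; case: closed_field_poly_normal => r /= {1}->.
by rewrite (monicP (char_poly_monic M)) scale1r.
Qed.

Lemma perm_eigenvalues n (M : 'M[R[i]]_n) r :
  char_poly M = \prod_(z <- r) ('X - z%:P) -> perm_eq (eigenvalues M) r.
Proof. by rewrite char_poly_eigenvalues => /prod_XsubC_eq. Qed.

Lemma size_eigenvalues n (M : 'M[R[i]]_n) : size (eigenvalues M) = n.
Proof.
have := size_char_poly M; rewrite char_poly_eigenvalues size_prod_XsubC.
by case.
Qed.

Lemma eigenvalues_add1 n (M : 'M[R[i]]_n) :
  perm_eq (eigenvalues (1%:M + M)) [seq 1 + z | z <- eigenvalues M].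
Proof.
apply: perm_eigenvalues; rewrite big_map.
have -> : char_poly (1%:M + M) = (char_poly M) \Po ('X - 1).
  rewrite /char_poly -det_map_mx; congr (\det _); apply/matrixP => i j.
  rewrite !mxE raddfB /= comp_polyC raddfMn /= comp_polyX polyCD polyCMn polyC1.
  by rewrite mulrnBl opprD addrA.
rewrite char_poly_eigenvalues rmorph_prod; apply: eq_bigr => z _ /=.
by rewrite raddfB /= comp_polyX comp_polyC polyCD polyC1 opprD addrA.
Qed.

(** Write [w = a + i b] with [a] and [b] real: the mixed terms cancel by symmetry, and the form is
    the sum of its values at [a] and [b], which are not both zero. *)
Lemma sym_posdef_herm n (A : 'M[R]_n) (w : 'rV[R[i]]_n) : sym_posdef A -> w != 0 ->
  exists2 t : R, 0 < t & (w *m complex_mx A *m (map_mx conjc w)^T) 0 0 = t%:C.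
Proof.
move=> [symA posA] w0.
pose a := map_mx (@complex.Re R) w; pose b := map_mx (@complex.Im R) w.
have wE : w = map_mx (real_complex R) a + 'i *: map_mx (real_complex R) b.
  by apply/rowP => k; rewrite !mxE -complexiE [LHS]complexE mulrC.
have wcE : map_mx conjc w = map_mx (real_complex R) a - 'i *: map_mx (real_complex R) b.
  by apply/rowP => k; rewrite !mxE -complexiE; case: (w 0 k) => x y; simpc.
have pos_row (x : 'rV[R]_n) : x != 0 -> 0 < (x *m A *m x^T) 0 0.
  by move=> x0; rewrite -{1}(trmxK x); apply: posA; rewrite trmx_eq0.
have ge_row (x : 'rV[R]_n) : 0 <= (x *m A *m x^T) 0 0.
  by have [->|/pos_row/ltW//] := eqVneq x 0; rewrite !mul0mx mxE.
exists ((a *m A *m a^T) 0 0 + (b *m A *m b^T) 0 0).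
  have [a0|a0] := eqVneq a 0; last by rewrite ltr_pwDl ?pos_row.
  rewrite ltr_wpDl ?pos_row //; apply: contraNneq w0 => b0.
  by rewrite wE a0 b0 !map_mx0 scaler0 addr0.
have ab : (a *m A *m b^T) 0 0 = (b *m A *m a^T) 0 0.
  have tr1 (B : 'M[R]_1) : B^T 0 0 = B 0 0 by rewrite mxE.
  by rewrite -[LHS]tr1 !trmx_mul trmxK symA mulmxA.
rewrite wcE wE; clearbody a b.
rewrite linearB /= linearZ /= !map_trmx mulmxBr !mulmxDl.
rewrite /complex_mx -!scalemxAr -!scalemxAl -!map_mxM.
move: ab; move: (a *m A *m a^T) (a *m A *m b^T) (b *m A *m a^T) (b *m A *m b^T).
move=> aa ab ba bb abE; rewrite !mxE abE rmorphD /=.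
have := sqrCi R[i]; rewrite expr2 => ii.
by rewrite mulrA ii mulN1r opprD opprK addrA addrK.
Qed.

Lemma sym_posdef_unit n (A : 'M[R]_n) : sym_posdef A -> A \in unitmx.
Proof.
move=> [_ posA]; rewrite unitmxE unitfE; apply/det0P => -[v v0 vA].
have := posA v^T; rewrite trmx_eq0 v0 trmxK vA mul0mx mxE ltxx.
by move=> /(_ isT).
Qed.

(** For a left eigenvector [v] with eigenvalue [z], the vector [w = v M^-1] satisfies
    [tau w K = z w M]. Pairing with the conjugate of [w] exhibits [z] as [tau] times a quotient of
    two positive numbers. *)
Lemma eigenvalues_Ztau n (M K : 'M[R]_n) tau :
  sym_posdef M -> sym_posdef K -> 0 < tau ->
  exists2 r : seq R, all (> 0) r &
    eigenvalues (complex_mx (Ztau M K tau)) = [seq x%:C | x <- r].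
Proof.
move=> pM pK tau0; have Mu := sym_posdef_unit pM.
set Z := complex_mx _.
have pos z : z \in eigenvalues Z -> exists2 x : R, 0 < x & z = x%:C.
  rewrite -root_prod_XsubC -char_poly_eigenvalues -eigenvalue_root_char.
  move=> /eigenvalueP[v vZ v0]; pose w := v *m complex_mx (invmx M).
  have vE : v = w *m complex_mx M.
    by rewrite /w -mulmxA -map_mxM mulVmx // map_mx1 mulmx1.
  have w0 : w != 0 by apply: contraNneq v0 => w0; rewrite vE w0 mul0mx.
  have [s s0 sE] := sym_posdef_herm pM w0.
  have [t t0 tE] := sym_posdef_herm pK w0.
  have wK : tau%:C *: (w *m complex_mx K) = z *: (w *m complex_mx M).
    by rewrite -vE -vZ /Z /Ztau /complex_mx map_mxZ map_mxM -scalemxAr mulmxA.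
  have scE (a : R[i]) (B : 'M[R[i]]_1) : (a *: B) 0 0 = a * B 0 0 by rewrite mxE.
  have h : tau%:C * t%:C = z * s%:C by rewrite -tE -sE -!scE scalemxAl wK -scalemxAl.
  exists (tau * t / s); first by rewrite divr_gt0 // mulr_gt0.
  have s0' : s%:C != 0 :> R[i] by rewrite fmorph_eq0 gt_eqF.
  by apply: (mulIf s0'); rewrite -h -!rmorphM /= divfK ?gt_eqF.
exists [seq complex.Re z | z <- eigenvalues Z].
  by rewrite all_map; apply/allP => z /pos[x x0 ->].
rewrite -map_comp -[LHS]map_id; apply/eq_in_map => z /pos[x x0 ->] //.
Qed.

(** This is [E(mu)], the block of the preconditioned matrix minus the identity that belongs to the
    eigenvalue [mu] of [Z]. *)
Definition error_symbol q (Li Uh : 'M[R]_q) (mu : R) : 'M[R]_q :=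
  invmx (1%:M + mu *: Li) *m Uh.

Lemma eigenvalues_precond q (Aq L U : 'M[R]_q) N (M K : 'M[R]_N) tau (r : seq R) :
  sym_posdef M -> L \in unitmx -> invmx Aq = L *m U ->
  {in r, forall mu, 1%:M + mu *: invmx L \in unitmx} ->
  eigenvalues (complex_mx (Ztau M K tau)) = [seq x%:C | x <- r] ->
  perm_eq
    (eigenvalues (complex_mx (invmx (precond_mx L M K tau) *m stage_mx Aq M K tau)))
    (flatten [seq eigenvalues
       (complex_mx (1%:M + error_symbol (invmx L) (U - 1%:M) mu)) | mu <- r]).
Proof.
move=> pM Lu AE Eu rE; have Mu := sym_posdef_unit pM.
pose Z := Ztau M K tau.
(* Both matrices of the quotient have the left factor [1 *t M], which cancels. *)
have ME (B : 'M[R]_q) : B *t M + tau *: (1%:M *t K) =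
    (1%:M *t M) *m (B *t 1%:M + 1%:M *t Z).
  rewrite mulmxDr !tensmx_mul !mul1mx mulmx1; congr (_ + _).
  rewrite /Z /Ztau -scalemxAr mulmxA mulmxV // mul1mx.
  by apply/matrixP => i j; rewrite !mxE; ring.
have MMu : (1%:M : 'M[R]_q) *t M \in unitmx.
  suff /mulmx1_unit[] : (1%:M *t M) *m ((1%:M : 'M[R]_q) *t invmx M) = 1%:M by [].
  by rewrite tensmx_mul mul1mx mulmxV // tensmx11.
have LE mu : L + mu%:M = L *m (1%:M + mu *: invmx L).
  by rewrite mulmxDr mulmx1 -scalemxAr mulmxV // scalemx1.
have Lmu mu : mu \in r -> L + mu%:M \in unitmx.
  by move=> mur; rewrite LE unitmx_mul Lu Eu.
(* This rests on [L U + mu = (L + mu) + L (U - 1)] and [L + mu = L (1 + mu L^-1)]. *)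
have symE mu : mu \in r ->
    invmx (L + mu%:M) *m (L *m U + mu%:M) = 1%:M + error_symbol (invmx L) (U - 1%:M) mu.
  move=> mur; apply: (can_inj (mulKmx (Lmu _ mur))).
  rewrite mulKVmx ?Lmu // mulmxDr mulmx1 /error_symbol [in X in _ = _ + X]LE.
  rewrite -mulmxA mulKVmx ?Eu // mulmxBr mulmx1.
  by rewrite addrC [L + _]addrC addrACA subrr addr0.
pose P0 := L *t 1%:M + 1%:M *t Z; pose S0 := (L *m U) *t 1%:M + 1%:M *t Z.
have tC (B : 'M[R]_q) : complex_mx (B *t 1%:M + 1%:M *t Z) =
    complex_mx B *t 1%:M + 1%:M *t complex_mx Z.
  by rewrite /complex_mx map_mxD !map_mxT !map_mx1.
have [P0u chP] : complex_mx P0 \in unitmx /\ char_poly (complex_mx (invmx P0 *m S0)) =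
    \prod_(z <- [seq x%:C | x <- r])
       char_poly (invmx (complex_mx L + z%:M) *m (complex_mx (L *m U) + z%:M)).
  have -> : complex_mx (invmx P0 *m S0) = invmx (complex_mx P0) *m complex_mx S0.
    by rewrite /complex_mx map_mxM map_invmx.
  rewrite [complex_mx P0]tC [complex_mx S0]tC; apply: char_poly_tens_pencil.
    by rewrite -rE char_poly_eigenvalues.
  move=> _ /mapP[mu mur ->].
  by rewrite -map_scalar_mx -map_mxD map_unitmx Lmu.
rewrite map_unitmx in P0u.
have -> : invmx (precond_mx L M K tau) *m stage_mx Aq M K tau = invmx P0 *m S0.
  rewrite /precond_mx /stage_mx AE !ME -/P0 -/S0.
  apply: (can_inj (mulKmx (_ : (1%:M *t M) *m P0 \in unitmx))).
    by rewrite unitmx_mul MMu.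
  by rewrite mulKVmx ?unitmx_mul ?MMu // -mulmxA mulKVmx.
apply: perm_eigenvalues; rewrite chP big_flatten /= !big_map.
rewrite big_seq [RHS]big_seq; apply: eq_bigr => mu mur.
rewrite -symE // -[RHS]char_poly_eigenvalues; congr char_poly.
by rewrite /complex_mx [in RHS]map_mxM map_invmx !map_mxD map_scalar_mx.
Qed.

End Eigenvalues.

(** * Backward elimination and the branches *)

Lemma coef_prod_linear (R : comNzRingType) n (f : 'I_n -> {poly R}) :
  (forall i, (size (f i) <= 2)%N) ->
  (size (\prod_i f i)%R <= n.+1)%N /\ (\prod_i f i)`_n = \prod_i (f i)`_1.
Proof.
elim: n f => [|n IH] f f2; first by rewrite !big_ord0 coef1 size_poly1.
have [szg gn] := IH (fun i => f (lift ord0 i)) (fun i => f2 _).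
rewrite !big_ord_recl -{}gn; set g := \prod_(i < n) _ in szg *.
split.
  apply: leq_trans (size_polyMleq _ _) _.
  by rewrite -subn1 leq_subLR; apply: leq_add (f2 ord0) szg.
have {1}-> : f ord0 = ((f ord0)`_0)%:P + (f ord0)`_1 *: 'X.
  apply/polyP => -[|[|k]]; rewrite coefD coefC coefZ coefX /=;
    rewrite ?mulr0 ?mulr1 ?addr0 ?add0r //.
  by rewrite nth_default // (leq_trans (f2 _)).
rewrite mulrDl coefD mul_polyC coefZ [g`_n.+1]nth_default // mulr0 add0r.
by rewrite -scalerAl coefZ coefXM.
Qed.

(** Every Leibniz term is a product of [n] polynomials of degree at most one. The formula will read
    [\det (1 + mu Li)] off the elimination polynomial. *)
Lemma det_pencil_lead (R : comNzRingType) n (A B : 'M[R]_n) :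
  (\det ('X *: map_mx polyC A - map_mx polyC B))`_n = \det A.
Proof.
rewrite /determinant coef_sum; apply: eq_bigr => s _ /=.
rewrite -[(-1) ^+ s in LHS](rmorph_sign polyC) coefCM; congr (_ * _).
pose f i := ('X *: map_mx polyC A - map_mx polyC B) i (s i).
have [i|_ ->] := @coef_prod_linear R n f.
  rewrite /f !mxE mulrC mul_polyC (leq_trans (size_polyD _ _)) // geq_max.
  rewrite (leq_trans (size_scale_leq _ _)) ?size_polyX //.
  by rewrite size_polyN (leq_trans (size_polyC_leq1 _)).
apply: eq_bigr => i _.
by rewrite /f !mxE coefB coefXM coefC /= coefC subr0.
Qed.

(** One substitution is a Schur complement with respect to the last diagonal entry. *)
Lemma det_substitute_last (F : fieldType) k (S : 'M[F]_k.+2) :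
  S ord_max ord_max != 0 ->
  \det S = S ord_max ord_max * \det (substitute_last S).
Proof.
move=> S0; set s := S _ _ in S0 *.
(* Right multiplication by the unitriangular [C] subtracts multiples of the last column, clearing
   the last row outside the pivot. *)
pose C : 'M[F]_k.+2 := \matrix_(i, j)
  ((i == j)%:R - ((i == ord_max) && (j != ord_max))%:R * (s^-1 * S ord_max j)).
have detC : \det C = 1.
  rewrite det_trig; last first.
    apply/is_trig_mxP => i j ij; rewrite mxE.
    have /negPf-> : i != j by rewrite -val_eqE ltn_eqF.
    have /negPf-> : i != ord_max by rewrite -val_eqE ltn_eqF // (leq_trans ij) // -ltnS.
    by rewrite mul0r subr0.
  rewrite big1 // => i _; rewrite mxE eqxx.
  by case: (i == ord_max); rewrite /= mul0r subr0.
have SC i j : (S *m C) i j =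
    S i j - (j != ord_max)%:R * (S i ord_max * s^-1 * S ord_max j).
  rewrite mxE; under eq_bigr do rewrite mxE mulrBr.
  rewrite sumrB (bigD1 j) //= eqxx mulr1 big1 ?addr0; last first.
    by move=> l /negPf ->; rewrite mulr0.
  congr (_ - _); rewrite (bigD1 ord_max) //= big1 ?addr0; last first.
    by move=> l /negPf ->; rewrite mul0r mulr0.
  by rewrite eqxx /= mulrCA !mulrA.
rewrite -[LHS]mulr1 -detC -det_mulmx (expand_det_row _ ord_max).
rewrite (bigD1 ord_max) //= big1 ?addr0; last first.
  by move=> j j0; rewrite SC j0 mul1r divff // mul1r subrr mul0r.
rewrite SC eqxx mul0r subr0 /cofactor -signr_odd oddD addbb mul1r.
congr (_ * \det _); apply/matrixP => i j.
have lw (l : 'I_k.+1) : lift ord_max l = widen_ord (leqnSn k.+1) l.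
  by apply/val_inj; rewrite /= /bump leqNgt ltn_ord.
rewrite 2!mxE SC 2!lw [in RHS]mxE (_ : _ != _) ?mul1r //.
by rewrite -val_eqE /= ltn_eqF.
Qed.

(** A nonzero result means that no pivot vanished, so that no substitution used the default value of
    the inverse of 0. *)
Lemma eliminate_det (F : fieldType) k (S : 'M[F]_k.+1) :
  eliminate S != 0 -> eliminate S = \det S.
Proof.
elim: k S => [|k IH] S; first by rewrite det_mx11.
rewrite /= mulf_eq0 negb_or => /andP[S0 /IH->].
by rewrite det_substitute_last.
Qed.

Section ReducedSystem.
Context {R : realType}.

(* reduced_system before the passage to the fraction field *)
Definition reduced_poly q (Uh Li : 'M[R]_q.+1) (mu : R) : 'M[{poly R}]_q.+1 :=
  \matrix_(i, j)
    if i == ord_max then ((i == j)%:R + mu * Li i j)%:P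
    else (Uh i j)%:P - ((i == j)%:R + mu * Li i j) *: 'X.

Lemma det_reduced_system q (Uh Li : 'M[R]_q.+1) mu :
  \det (reduced_system Uh Li mu) = tofrac (\det (reduced_poly Uh Li mu)).
Proof.
rewrite -det_map_mx; congr (\det _); apply/matrixP => i j; rewrite !mxE.
by case: ifP.
Qed.

(** Row by row the two matrices differ by the factor [-1], except in the last row, where [Uh]
    vanishes and the factor is ['X]. This factor accounts for the eigenvalue 0. *)
Lemma det_pencil_reduced q (Uh Li : 'M[R]_q.+1) mu :
  (forall j, Uh ord_max j = 0) ->
  \det ('X *: map_mx polyC (1%:M + mu *: Li) - map_mx polyC Uh) =
  (-1) ^+ q * 'X * \det (reduced_poly Uh Li mu).
Proof.
move=> Uh0.
pose d : 'rV[{poly R}]_q.+1 := \row_i if i == ord_max then 'X else -1.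
have -> : 'X *: map_mx polyC (1%:M + mu *: Li) - map_mx polyC Uh =
    diag_mx d *m reduced_poly Uh Li mu.
  apply/matrixP => i j; rewrite mul_diag_mx !mxE; case: (eqVneq i ord_max) => [->|_].
    by rewrite Uh0 subr0.
  by rewrite mulN1r opprB mulrC mul_polyC.
rewrite det_mulmx det_diag; congr (_ * _).
rewrite big_ord_recr mxE eqxx; congr (_ * _).
rewrite -[in RHS](card_ord q) -prodr_const; apply: eq_bigr => i _.
by rewrite mxE -val_eqE /= ltn_eqF.
Qed.

Lemma lists_roots_size m (P : {poly R}) (lam : 'I_m -> R[i]) :
  lists_roots P lam -> size P = m.+1.
Proof.
rewrite /lists_roots => -[P0 PE].
rewrite -(size_map_poly (real_complex R)) PE size_scale ?lead_coef_eq0 //.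
by rewrite size_prod_XsubC /index_enum -enumT size_enum_ord.
Qed.

(** Up to a nonzero constant the characteristic polynomial is ['X] times the polynomial with roots
    [lam]; the constant is found by comparing leading coefficients. *)
Lemma eigenvalues_error_symbol p (Uh Li : 'M[R]_p.+2) mu (lam : 'I_p.+1 -> R[i]) :
  (forall j, Uh ord_max j = 0) ->
  lists_roots (\det (reduced_poly Uh Li mu)) lam ->
  1%:M + mu *: Li \in unitmx /\
  perm_eq (eigenvalues (complex_mx (error_symbol Li Uh mu)))
          (0 :: [seq lam k | k <- enum 'I_p.+1]).
Proof.
move=> Uh0; set P := \det _ => /[dup] /lists_roots_size szP.
rewrite /lists_roots; set PC := map_poly _ P => -[PC0 PCE]; set A := 1%:M + _.
have detE := det_pencil_reduced Li mu Uh0.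
(* P has degree p + 1, so its leading coefficient is det A up to sign. *)
have detA : \det A = (-1) ^+ p.+1 * lead_coef P.
  rewrite -(det_pencil_lead A Uh) detE -mulrA -(rmorph_sign polyC) coefCM coefXM /=.
  by rewrite lead_coefE szP.
have Au : A \in unitmx.
  rewrite unitmxE unitfE detA mulf_neq0 ?signr_eq0 // lead_coef_eq0.
  by rewrite -(map_poly_eq0 (real_complex R)).
split=> //.
have chE := char_poly_pencil Uh Au; rewrite detE in chE.
have chC := congr1 (map_poly (real_complex R)) chE.
apply: perm_eigenvalues; rewrite big_cons big_map big_enum /= subr0.
rewrite /complex_mx -map_char_poly.
move: chC; rewrite map_polyZ !rmorphM /= rmorph_sign map_polyX -/PC PCE => chC.
set D := (real_complex R) (\det A) in chC.
have D0 : D != 0 by rewrite fmorph_eq0 -unitfE -unitmxE.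
have {chC} chC : D *: map_poly (real_complex R) (char_poly (error_symbol Li Uh mu)) =
   ((-1) ^+ p.+1 * lead_coef PC) *: ('X * \prod_k ('X - (lam k)%:P)).
  by rewrite chC -(rmorph_sign polyC) -mulrA mul_polyC -scalerAr scalerA.
apply: (scalerI D0); rewrite chC; congr (_ *: _).
by rewrite lead_coef_map /D detA rmorphM /= rmorph_sign.
Qed.

End ReducedSystem.

Section BranchRoots.
Context {R : realType}.
Implicit Types mu : R.

(** As [P] is nonzero the elimination does compute the determinant, and the passage to fractions is
    injective. *)
Lemma eliminate_reduced_system q (Uh Li : 'M[R]_q.+1) mu (P : {poly R}) :
  P != 0 -> tofrac P = eliminate (reduced_system Uh Li mu) ->
  \det (reduced_poly Uh Li mu) = P.
Proof.
move=> P0 PE; set S := reduced_system _ _ _ in PE *.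
have S0 : eliminate S != 0 by rewrite -PE tofrac_eq0.
have DE : tofrac (\det (reduced_poly Uh Li mu)) = tofrac P.
  by rewrite PE (eliminate_det S0) -det_reduced_system.
by apply/eqP; rewrite -tofrac_eq; apply/eqP.
Qed.

Lemma det_mx2 (S : comNzRingType) (A : 'M[S]_2) :
  \det A = A ord0 ord0 * A ord_max ord_max - A ord0 ord_max * A ord_max ord0.
Proof.
rewrite (expand_det_row _ ord0) !big_ord_recl big_ord0 /cofactor !det_mx11 !mxE.
rewrite addr0 /= expr0 expr1 mul1r mulN1r mulrN.
by congr (_ * A _ _ - A _ _ * A _ _); apply/val_inj.
Qed.

Lemma det_mx3 (S : comNzRingType) (A : 'M[S]_3)
    (a := fun i j : nat => A (inord i) (inord j)) :
  \det A = a 0%N 0%N * (a 1%N 1%N * a 2%N 2%N - a 1%N 2%N * a 2%N 1%N)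
         - a 0%N 1%N * (a 1%N 0%N * a 2%N 2%N - a 1%N 2%N * a 2%N 0%N)
         + a 0%N 2%N * (a 1%N 0%N * a 2%N 1%N - a 1%N 1%N * a 2%N 0%N).
Proof.
rewrite (expand_det_row _ ord0) !big_ord_recl big_ord0 /cofactor !det_mx2 !mxE.
have aE i j (x y : 'I_3) : x = i :> nat -> y = j :> nat -> A x y = a i j.
  by move=> <- <-; rewrite /a !inord_val.
clearbody a; rewrite !addr0.
repeat match goal with |- context [fun_of_matrix A ?x ?y] =>
  rewrite (aE _ _ x y erefl erefl) /= end.
have [-> ->] : bump 0 0 = 1%N /\ bump 0 1 = 2%N by [].
have [-> ->] : bump 1 0 = 0%N /\ bump 1 1 = 2%N by [].
have [-> ->] : bump 2 0 = 0%N /\ bump 2 1 = 1%N by [].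
by rewrite !add0n expr0 expr1 sqrrN expr1n; ring.
Qed.

(** Forward substitution: in entry [(i, j)] of [L L^-1 = 1] with [i < j], the terms [k < i] vanish
    by induction on the row and the terms [k > i] by triangularity of [L], leaving [L i i] times the
    entry sought. *)
Lemma is_trig_invmx (F : fieldType) n (L : 'M[F]_n) :
  L \in unitmx -> is_trig_mx L -> is_trig_mx (invmx L).
Proof.
move=> Lu /[dup] Ltrig /is_trig_mxP L0; apply/is_trig_mxP => i.
have Ld k : L k k != 0.
  move: Lu; rewrite unitmxE unitfE det_trig // => /prodf_neq0; exact.
have [m] := ubnP i; elim: m i => // m IH i; rewrite ltnS => im j ij.
have := congr1 (fun B : 'M[F]_n => B i j) (mulmxV Lu).
rewrite !mxE -val_eqE ltn_eqF // (bigD1 i) //= big1 ?addr0.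
  by move/eqP; rewrite mulf_eq0 (negPf (Ld _)) => /eqP.
move=> k ki; have [ik|] := ltnP i k; first by rewrite L0 ?mul0r.
rewrite leq_eqVlt val_eqE (negPf ki) /= => ltki.
by rewrite IH ?mulr0 // ?(leq_trans ltki) // ltnW.
Qed.

Lemma lists_roots_quadratic (Uh Li : 'M[R]_3) mu (lam : 'I_2 -> R[i]) :
  (forall i j : 'I_3, (j <= i)%N -> Uh i j = 0) -> is_trig_mx Li ->
  lists_roots (quadratic_q3 Uh Li mu) lam ->
  lists_roots (\det (reduced_poly Uh Li mu)) lam.
Proof.
move=> Uh0 /is_trig_mxP Li0 Plam; have szP := lists_roots_size Plam.
suff -> : \det (reduced_poly Uh Li mu) = quadratic_q3 Uh Li mu by [].
have Uz i j : (i <= 2)%N -> (j <= i)%N -> Uh (inord i) (inord j) = 0.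
  by move=> i2 ji; rewrite Uh0 // !inordK // ltnS (leq_trans ji).
have Liz i j : (j <= 2)%N -> (i < j)%N -> Li (inord i) (inord j) = 0.
  by move=> j2 ij; rewrite Li0 // !inordK // ltnS (leq_trans (ltnW ij)).
have eqo i j : (i <= 2)%N -> (j <= 2)%N -> (inord i == inord j :> 'I_3) = (i == j).
  by move=> i2 j2; rewrite -val_eqE /= !inordK.
have om : ord_max = inord 2 :> 'I_3 by apply/val_inj; rewrite /= inordK.
(* This number is a factor of the only term of degree 2, and two listed roots force the degree to be
   2. *)
have l33 : 1 + Li (inord 2) (inord 2) * mu != 0.
  apply/eqP => l33; have : (quadratic_q3 Uh Li mu)`_2 != 0.
    have := lead_coef_eq0 (quadratic_q3 Uh Li mu); rewrite lead_coefE szP => ->.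
    by rewrite -size_poly_eq0 szP.
  rewrite /quadratic_q3 /l1_q3 /l2_q3 /= l33 !mulr0 !scale0r oppr0 add0r addr0.
  by rewrite !(coefB, coefN, coefD, coefZ, coefC, coefX) /= !(mulr0, addr0, oppr0) eqxx.
rewrite det_mx3 !mxE om !eqo //= (Uz 0 0)%N // (Uz 1 0)%N // (Uz 1 1)%N //.
rewrite (Liz 0 1)%N // (Liz 0 2)%N // (Liz 1 2)%N // /quadratic_q3 /l1_q3 /l2_q3 /=.
have := divff l33; set k := (_ + _)^-1 => /(congr1 polyC).
rewrite -!mul_polyC !(polyCM, polyCD, polyCN, polyC1, polyC0).
rewrite !(add0r, mulr0, mul1r, sub0r, mul0r, subr0).
clearbody k => kE; set l33P := (Li (inord 2) (inord 2))%:P in kE *.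
(* The inverse of [1 + l33 mu] is now an indeterminate [k], and this relation is the rewriting rule
   handed to [ring]. *)
have {}kE : k%:P * l33P * mu%:P = 1 - k%:P by rewrite -[in RHS]kE; ring.
ring: kE.
Qed.

End BranchRoots.

(** * The Radau IIA matrix *)

Section Radau.
Context {R : realType}.

Lemma integral_deriv_poly (P : {poly R}) (a : R) : 0 < a ->
  \int[lebesgue_measure]_(x in `[0, a]) (P^`()).[x] = P.[a] - P.[0].
Proof.
move=> a0; rewrite /Rintegral (@continuous_FTC2 _ _ (horner P)) //.
- by apply: continuous_subspaceT; exact: continuous_horner.
- split=> [x _||]; first exact: derivable_horner.
    by apply: cvg_at_right_filter; exact: continuous_horner.
  by apply: cvg_at_left_filter; exact: continuous_horner.
- by move=> x _; rewrite -derivE.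
Qed.

(* The junk value x / 0 = 0 makes the constant coefficient vanish. *)
Definition prim_poly (p : {poly R}) : {poly R} :=
  \poly_(i < (size p).+1) (p`_i.-1 / i%:R).

Lemma deriv_prim_poly p : (prim_poly p)^`() = p.
Proof.
apply/polyP => i; rewrite coef_deriv coef_poly ltnS.
case: ltnP => [_|szi]; last by rewrite mul0rn nth_default.
by rewrite -[LHS]mulr_natr divfK // pnatr_eq0.
Qed.

Lemma prim_poly_at0 p : (prim_poly p).[0] = 0.
Proof. by rewrite horner_coef0 coef_poly /= invr0 mulr0. Qed.

(** The signs alternate, since multiplication by ['X - 1] adds two contributions of equal sign to
    each coefficient. *)
Lemma sign_coef_XsubC1 n i : 0 <= (-1) ^+ (n + i) * (('X - 1 : {poly R}) ^+ n)`_i.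
Proof.
elim: n i => [|n IH] i.
  by rewrite expr0 coef1; case: i => [|i] /=; rewrite ?mulr0 ?expr0 ?mulr1.
rewrite exprSr mulrBr mulr1 coefB coefMX mulrBr.
have := IH i; rewrite addSn exprS mulN1r !mulNr opprK => IHi.
case: i IHi => [|i] IHi /=; first by rewrite mulr0 oppr0 add0r.
rewrite addr_ge0 //; have := IH i.
by rewrite addnS exprS mulN1r mulNr opprK.
Qed.

(* At x <= 0 all the monomials of the polynomial have the same sign. *)
Lemma radau_root_gt0 q (x : R) : root (radau_poly q.+1) x -> 0 < x.
Proof.
apply: contraLR; rewrite -leNgt => x0.
(* The factor ['X^q] shifts the coefficients by [q], and the [q]-th derivative shifts them back with
   a falling factorial. *)
have rE i : (radau_poly q.+1 : {poly R})`_i =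
    (('X - 1) ^+ q.+1)`_i *+ (q + i) ^_ q.
  by rewrite /radau_poly coef_derivn coefXnM ltnNge leq_addr /= addKn.
have r0 : (radau_poly q.+1 : {poly R})`_0 = (-1) ^+ q.+1 *+ q`!.
  rewrite rE addn0 ffactnn; congr (_ *+ _).
  by rewrite -horner_coef0 horner_exp hornerD hornerN hornerX hornerC add0r.
have sz : (0 < size (radau_poly q.+1 : {poly R})%R)%N.
  rewrite lt0n size_poly_eq0; apply: contraTneq isT => p0.
  move/eqP: r0; rewrite p0 coef0 eq_sym mulrn_eq0 signr_eq0 orbF.
  by rewrite -leqn0 leqNgt fact_gt0.
apply: contraTneq (ltr01 : (0 : R) < 1); rewrite -leNgt => rx.
(* Strictness comes from the constant term, whose signed value is [q!]; the other terms are only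
   nonnegative. *)
have : 0 < (-1) ^+ q.+1 * (radau_poly q.+1).[x].
  rewrite horner_coef mulr_sumr; case: (size _) sz => // s _.
  rewrite big_ord_recl expr0 mulr1 r0 mulrnAr -expr2 sqrr_sign.
  rewrite ltr_pwDl ?ltr0n ?fact_gt0 // sumr_ge0 // => i _.
  set j := lift _ _; set r := _`_j.
  have -> : (-1) ^+ q.+1 * (r * x ^+ j) = (-1) ^+ (q.+1 + j) * r * (- x) ^+ j.
    by rewrite -[in LHS](opprK x) (exprNn (- x)) exprD; ring.
  rewrite mulr_ge0 ?exprn_ge0 ?oppr_ge0 // /r rE mulrnAr mulrn_wge0 //.
  exact: sign_coef_XsubC1.
by rewrite rx mulr0 ltxx.
Qed.

Lemma radau_nodes_gt0 q (c : 'I_q.+1 -> R) : radau_nodes c -> forall i, 0 < c i.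
Proof.
by case=> _ _ rc i; apply: (@radau_root_gt0 q); apply/rc; exists i.
Qed.

Lemma radau_nodes_inj q (c : 'I_q.+1 -> R) : radau_nodes c -> injective c.
Proof.
move=> [c_lt _ _] i j cij; apply/val_inj.
by case: (ltngtP i j) => // /c_lt; rewrite cij ltxx.
Qed.

Lemma lagrange_polyE q (c : 'I_q -> R) (j k : 'I_q) : injective c ->
  (lagrange_poly c j).[c k] = (k == j)%:R.
Proof.
move=> injc; rewrite /lagrange_poly hornerZ.
have [->|kj] := eqVneq k j.
  rewrite mulVf // horner_prod; apply/prodf_neq0 => i ij.
  by rewrite hornerXsubC subr_eq0 (inj_eq injc) eq_sym.
set w := \prod_(i | _) _; have -> : w.[c k] = 0 by
  rewrite /w horner_prod (bigD1 k) //= hornerXsubC subrr mul0r.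
by rewrite mulr0.
Qed.

Lemma size_lagrange_poly q (c : 'I_q -> R) (j : 'I_q) :
  (size (lagrange_poly c j) <= q)%N.
Proof.
rewrite /lagrange_poly (leq_trans (size_scale_leq _ _)) //.
rewrite -big_filter size_prod_XsubC size_filter -[leqRHS](card_ord q).
by rewrite -sum1_card -sum1_count [X in (_ < X)%N](bigD1 j).
Qed.

(* A combination of the columns is the list of the values at the nodes of a
   polynomial of degree at most q + 1 that also vanishes at 0, hence has q + 2
   roots if the combination is zero. *)
Lemma radau_mx_unit q (c : 'I_q.+1 -> R) : radau_nodes c -> radau_mx c \in unitmx.
Proof.
move=> hc; have injc := radau_nodes_inj hc; have c0 := radau_nodes_gt0 hc.
rewrite -unitmx_tr unitmxE unitfE; apply/det0P => -[v v0 vA].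
pose p := \sum_j v 0 j *: lagrange_poly c j.
have pc k : p.[c k] = v 0 k.
  rewrite horner_sum (bigD1 k) //= hornerZ lagrange_polyE // eqxx mulr1.
  rewrite big1 ?addr0 // => j jk.
  by rewrite hornerZ lagrange_polyE // eq_sym (negPf jk) mulr0.
have primp : p = (\sum_j v 0 j *: prim_poly (lagrange_poly c j))^`().
  rewrite raddf_sum; apply: eq_bigr => j _.
  by rewrite /= derivZ deriv_prim_poly.
set P := \sum_j v 0 j *: prim_poly _ in primp.
have szP : (size P <= q.+2)%N.
  apply: (big_ind (fun P : {poly R} => (size P <= q.+2)%N)).
  - by rewrite size_poly0.
  - by move=> x y sx sy; rewrite (leq_trans (size_polyD _ _)) // geq_max sx.
  move=> j _; rewrite (leq_trans (size_scale_leq _ _)) //.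
  by rewrite (leq_trans (size_poly _ _)) // ltnS size_lagrange_poly.
have P0 : P = 0.
  apply: (@roots_geq_poly_eq0 _ P (0 :: [seq c i | i <- enum 'I_q.+1])).
  - rewrite /= rootE horner_sum big1 ?eqxx /=; last first.
      by move=> j _; rewrite hornerZ prim_poly_at0 mulr0.
    apply/allP => _ /mapP[i _ ->]; rewrite rootE; apply/eqP.
    have := congr1 (fun B : 'rV[R]_q.+1 => B 0 i) vA.
    rewrite !mxE => <-; rewrite horner_sum; apply: eq_bigr => j _.
    rewrite hornerZ !mxE -[in RHS](deriv_prim_poly (lagrange_poly c j)).
    by rewrite integral_deriv_poly // prim_poly_at0 subr0.
  - rewrite /= map_inj_uniq // enum_uniq andbT.
    by apply/mapP => -[i _ /eqP]; rewrite lt_eqF.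
  by rewrite /= size_map size_enum_ord.
case/eqP: v0; apply/rowP => k.
by rewrite -pc primp P0 deriv0 horner0 mxE.
Qed.

Lemma radau_mx2 (c : 'I_2 -> R) : radau_nodes c ->
  [/\ radau_mx c ord0 ord0 = 5 / 12, radau_mx c ord0 ord_max = - 1 / 12,
      radau_mx c ord_max ord0 = 3 / 4 & radau_mx c ord_max ord_max = 1 / 4].
Proof.
move=> hc; have c0 := radau_nodes_gt0 hc; case: (hc) => c_lt c1 rc.
have lt01 : c ord0 < 1 by rewrite -c1; apply: c_lt.
have c0E : c ord0 = 1 / 3.
  have : root (radau_poly 2) (c ord0) by apply/rc; exists ord0.
  have -> : radau_poly 2 = ('X * ('X - 1) ^+ 2)^`() :> {poly R} by [].
  rewrite derivM derivX deriv_exp derivB derivX -polyC1 derivC rootE.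
  rewrite !(hornerE, horner_exp) => /eqP e.
  (* The derivative of [X (X - 1)^2] factors as [(X - 1) (3 X - 1)], and [c ord0 < 1] selects the
     root 1/3. *)
  have : (c ord0 - 1) * (3 * c ord0 - 1) = 0 by rewrite -e; ring.
  move=> /eqP; rewrite mulf_eq0 subr_eq0 lt_eqF //= => /eqP; lra.
have entry i (j k : 'I_2) : j != k -> radau_mx c i j =
    (c j - c k)^-1 * (c i ^+ 2 / 2 - c k * c i).
  move=> jk; rewrite mxE /lagrange_poly.
  have -> : \prod_(l < 2 | l != j) ('X - (c l)%:P) = 'X - (c k)%:P.
    rewrite (bigD1 k) 1?eq_sym //= big1 ?mulr1 // => l /andP[lj lk].
    by move: jk lj lk; case: j k l => [[|[|//]] ?] [[|[|//]] ?] [[|[|//]] ?].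
  rewrite hornerXsubC.
  pose P : {poly R} := (c j - c k)^-1 *: (2^-1 *: 'X^2 - c k *: 'X).
  have -> : (c j - c k)^-1 *: ('X - (c k)%:P) = P^`().
    rewrite /P derivZ derivB !derivZ derivXn derivX -scalerMnr scalerMnl.
    by rewrite -[_^-1 *+ 2]mulr_natr mulVf ?pnatr_eq0 // scale1r alg_polyC.
  rewrite integral_deriv_poly ?radau_nodes_gt0 // /P.
  by rewrite !(hornerZ, hornerD, hornerN, hornerXn, hornerX); ring.
have c1E : c ord_max = 1 by [].
have n01 : (ord0 : 'I_2) != ord_max by [].
have n10 : (ord_max : 'I_2) != ord0 by [].
rewrite !(entry _ _ _ n01) !(entry _ _ _ n10) c1E c0E.
have -> : 1 / 3 - 1 = - (2 / 3) :> R by field.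
have -> : 1 - 1 / 3 = 2 / 3 :> R by field.
by split; field.
Qed.

(** Reading [L U A = 1] as [L (U A) = 1] expresses the inverse of [L] through [U] and [A], which
    makes its entries computable for two stages. *)
Lemma LU_unit q (A L U : 'M[R]_q) : A \in unitmx ->
  LU_factorization (invmx A) L U -> L \in unitmx /\ invmx L = U *m A.
Proof.
move=> Au [_ _ _ AE].
have LUA : L *m (U *m A) = 1%:M by rewrite mulmxA -AE mulVmx.
have [Lu _] := mulmx1_unit LUA; split=> //.
by rewrite -[RHS](mulKmx Lu) LUA mulmx1.
Qed.

Lemma lists_roots_branch_q2 (c : 'I_2 -> R) (L U : 'M[R]_2) mu (lam : 'I_1 -> R[i]) :
  radau_nodes c -> LU_factorization (invmx (radau_mx c)) L U -> 0 < mu ->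
  lam ord0 = (branch_q2 mu)%:C ->
  lists_roots (\det (reduced_poly (U - 1%:M) (invmx L) mu)) lam.
Proof.
move=> hc LU mu0 lamE; have [Lu LiE] := LU_unit (radau_mx_unit hc) LU.
case: LU => Ltrig U0 U1 _; have [a00 a01 a10 a11] := radau_mx2 hc.
have UA i j : invmx L i j =
    U i ord0 * radau_mx c ord0 j + U i ord_max * radau_mx c ord_max j.
  rewrite LiE mxE !big_ord_recl big_ord0 addr0.
  by congr (_ + U _ _ * radau_mx c _ _); apply/val_inj.
(* The upper right entry of [U A], the inverse of a lower triangular matrix, is 0; this equation
   determines the one unknown entry of [U]. *)
have Uu : U ord0 ord_max = 1 / 3.
  have := UA ord0 ord_max; rewrite (is_trig_mxP (is_trig_invmx Lu Ltrig)) //.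
  by rewrite a01 a11 U1 => h; lra.
have U10 : U ord_max ord0 = 0 by apply: U0.
have l00 : invmx L ord0 ord0 = 2 / 3 by rewrite UA U1 Uu a00 a10; field.
have l01 : invmx L ord0 ord_max = 0 by rewrite UA U1 Uu a01 a11; field.
have l10 : invmx L ord_max ord0 = 3 / 4 by rewrite UA U1 U10 a00 a10; field.
have l11 : invmx L ord_max ord_max = 1 / 4 by rewrite UA U1 U10 a01 a11; field.
pose a : R := (1 + mu * (2 / 3)) * (1 + mu * (1 / 4)).
have a0 : 0 < a by rewrite /a mulr_gt0 // addr_gt0 // mulr_gt0.
have -> : \det (reduced_poly (U - 1%:M) (invmx L) mu) =
    - a *: ('X - (branch_q2 mu)%:P).
  rewrite det_mx2 !mxE /= l00 l01 l10 l11 Uu U1.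
  rewrite !subrr !mulr0 !addr0 scale0r subr0 sub0r.
  (* Here [a] is [\det (1 + mu L^-1)], and [4 mu^-1 a] is the denominator in [branch_q2]. *)
  have ab : a * branch_q2 mu = - (mu / 4).
    rewrite /branch_q2 /a; field.
    by apply/andP; split; apply: lt0r_neq0; nra.
  rewrite scalerBr !scaleNr opprK -[X in _ = _ + X]mul_polyC -polyCM ab.
  rewrite -polyCM (_ : (1 / 3 - 0) * _ = mu / 4); last by field.
  by rewrite polyCN -!mul_polyC /a polyCM; ring.
have a0' : - a%:C != 0 by rewrite oppr_eq0 fmorph_eq0 gt_eqF.
rewrite /lists_roots map_polyZ map_polyXsubC /= rmorphN big_ord1 lamE /=.
split; first by rewrite scaler_eq0 negb_or a0' polyXsubC_eq0.
by rewrite lead_coefZ (monicP (monicXsubC _)) mulr1.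
Qed.

End Radau.

(** * The symbol *)

Section BranchSymbol.
Context {R : realType} (p : nat) (c : 'I_p.+2 -> R) (L U : 'M[R]_p.+2).
Hypotheses (hc : radau_nodes c) (hLU : LU_factorization (invmx (radau_mx c)) L U).

Lemma unitriangular_sub1 (i j : 'I_p.+2) : (j <= i)%N -> (U - 1%:M) i j = 0.
Proof.
case: hLU => _ U0 U1 _; rewrite leq_eqVlt !mxE => /orP[/eqP/val_inj->|ji].
  by rewrite eqxx U1 subrr.
by rewrite U0 // eq_sym -val_eqE ltn_eqF // subr0.
Qed.

Lemma L_unit : L \in unitmx.
Proof. by have [] := LU_unit (radau_mx_unit hc) hLU. Qed.

(** The three descriptions of the branches are unified here: from now on they are the roots of a
    single determinant, whatever the number of stages. *)
Lemma lists_roots_branch mu lam : 0 < mu ->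
  branch_values (U - 1%:M) (invmx L) mu lam ->
  lists_roots (\det (reduced_poly (U - 1%:M) (invmx L) mu)) lam.
Proof.
move=> mu0; have := unitriangular_sub1; have := L_unit; have [Ltrig _ _ _] := hLU.
case: p c L U hc hLU Ltrig lam => [|[|q]] c' L' U' hc' hLU' Ltrig lam Lu Uz.
- exact: lists_roots_branch_q2 hc' hLU' mu0.
- by apply: lists_roots_quadratic => //; exact: is_trig_invmx.
- move=> [P PE /[dup] lP [P0 _]]; rewrite (eliminate_reduced_system _ PE) //.
  by apply: contraNneq P0 => ->; rewrite map_poly0.
Qed.

Lemma eigenvalues_branch mu lam : 0 < mu ->
  branch_values (U - 1%:M) (invmx L) mu lam ->
  1%:M + mu *: invmx L \in unitmx /\
  perm_eq (eigenvalues (complex_mx (1%:M + error_symbol (invmx L) (U - 1%:M) mu)))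
          (1 :: [seq 1 + lam k | k <- enum 'I_p.+1]).
Proof.
move=> mu0 /(lists_roots_branch mu0) hlam.
have [|Eu pE] := eigenvalues_error_symbol _ hlam.
  by move=> j; rewrite unitriangular_sub1 // -ltnS.
split=> //; rewrite /complex_mx map_mxD map_mx1.
apply: perm_trans (eigenvalues_add1 _) _.
by apply: perm_trans (perm_map _ pE) _; rewrite /= addr0 -map_comp.
Qed.

Lemma eigenvalues_branch_symbol (lam : 'I_p.+1 -> R -> R[i]) mu :
  perm_eq (eigenvalues (branch_symbol lam mu))
          (1 :: [seq 1 + (if 0 < mu then lam k mu else 0) | k <- enum 'I_p.+1]).
Proof.
apply: perm_eigenvalues; rewrite char_poly_trig; last exact/diag_mx_is_trig.
rewrite big_ord_recl big_cons big_map big_enum !mxE eqxx unlift_none.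
congr (_ * _); apply: eq_bigr => k _.
by rewrite !mxE eqxx liftK.
Qed.

End BranchSymbol.

(** * Continuity of roots *)

Section RootConvergence.
Context {K : numFieldType} {T : Type} {F : set_system T} {FF : Filter F}.

Lemma cvg_sumr (I : Type) (r : seq I) (f : I -> T -> K^o) (a : I -> K^o) :
  (forall i, f i t @[t --> F] --> a i) ->
  \sum_(i <- r) f i t @[t --> F] --> \sum_(i <- r) a i.
Proof.
by move=> fa; apply: cvg_big => // -[x y]; exact: (@add_continuous K^o).
Qed.

Lemma cvg_prodr (I : Type) (r : seq I) (f : I -> T -> K^o) (a : I -> K^o) :
  (forall i, f i t @[t --> F] --> a i) ->
  \prod_(i <- r) f i t @[t --> F] --> \prod_(i <- r) a i.
Proof.
move=> fa; apply: cvg_big => // -[x y].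
by apply: cvgM; [exact: cvg_fst|exact: cvg_snd].
Qed.

Lemma cvg_det n (M : T -> 'M[K]_n) (M0 : 'M[K]_n) :
  (forall i j, (M t i j : K^o) @[t --> F] --> (M0 i j : K^o)) ->
  (\det (M t) : K^o) @[t --> F] --> (\det M0 : K^o).
Proof.
move=> MM; apply: cvg_sumr => s; apply: cvgM; first exact: cvg_cst.
exact: cvg_prodr.
Qed.

Lemma cvg_invmx n (M : T -> 'M[K]_n) (M0 : 'M[K]_n) :
  (forall i j, (M t i j : K^o) @[t --> F] --> (M0 i j : K^o)) ->
  M0 \in unitmx ->
  forall i j, (invmx (M t) i j : K^o) @[t --> F] --> (invmx M0 i j : K^o).
Proof.
move=> MM M0u i j; have detMM := cvg_det MM.
have detM0 : (\det M0 : K^o) != 0 by rewrite -unitfE -unitmxE.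
rewrite /invmx M0u !mxE.
(* On a singular matrix [invmx] is the identity map, so the cofactor formula is available only
   eventually, once [\det (M t)] is nonzero. *)
apply: (@cvg_trans _ ((((\det (M t))^-1 *: \adj (M t)) i j : K^o) @[t --> F])).
  apply: near_eq_cvg; near=> t.
  suff -> : M t \in unitmx by [].
  rewrite unitmxE unitfE; near: t.
  exact: (cvgr_neq0 _ detMM detM0).
under eq_fun do rewrite !mxE.
apply: cvgM; first exact: cvgV.
apply: cvgM; first exact: cvg_cst.
apply: cvg_det => k l; rewrite !mxE; under eq_fun do rewrite !mxE.
exact: MM.
Unshelve. all: by end_near. Qed.

Lemma cvg_mulmx m n p (A : T -> 'M[K]_(m, n)) (B : T -> 'M[K]_(n, p))
    (A0 : 'M[K]_(m, n)) (B0 : 'M[K]_(n, p)) :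
  (forall i j, (A t i j : K^o) @[t --> F] --> (A0 i j : K^o)) ->
  (forall i j, (B t i j : K^o) @[t --> F] --> (B0 i j : K^o)) ->
  forall i j, ((A t *m B t) i j : K^o) @[t --> F] --> ((A0 *m B0) i j : K^o).
Proof.
move=> AA BB i j; rewrite mxE; under eq_fun do rewrite mxE.
by apply: cvg_sumr => k; apply: cvgM; [exact: AA|exact: BB].
Qed.

Definition coef_cvg (P : T -> {poly K}) (p : {poly K}) :=
  forall k, ((P t)`_k : K^o) @[t --> F] --> (p`_k : K^o).

Lemma coef_cvgM P Q p q : coef_cvg P p -> coef_cvg Q q ->
  coef_cvg (fun t => P t * Q t) (p * q).
Proof.
move=> Pp Qq k; rewrite coefM; under eq_fun do rewrite coefM.
by apply: cvg_sumr => i; apply: cvgM; [exact: Pp|exact: Qq].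
Qed.

Lemma coef_cvg_char_poly n (M : T -> 'M[K]_n) (M0 : 'M[K]_n) :
  (forall i j, (M t i j : K^o) @[t --> F] --> (M0 i j : K^o)) ->
  coef_cvg (fun t => char_poly (M t)) (char_poly M0).
Proof.
move=> MM k; rewrite /char_poly /determinant coef_sum.
under eq_fun do rewrite coef_sum.
apply: cvg_sumr => s; apply: coef_cvgM => {k}; first by move=> k; exact: cvg_cst.
elim: (index_enum _) => [|i r IH].
  by under eq_fun do rewrite big_nil; rewrite big_nil => k; exact: cvg_cst.
under eq_fun do rewrite big_cons; rewrite big_cons.
apply: coef_cvgM => // {IH} k; rewrite !mxE.
under eq_fun do rewrite !mxE.
rewrite coefB; under eq_fun do rewrite coefB.
apply: cvgB; first exact: cvg_cst.
rewrite coefC; under eq_fun do rewrite coefC.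
by case: k => [|k]; [exact: MM|exact: cvg_cst].
Qed.

(** A factor of least norm works. Applied to the differences between a point and the roots of a
    monic polynomial, it gives a root near any point where the polynomial is small. *)
Lemma min_norm_prod (s : seq K) : s != [::] ->
  exists2 y, y \in s & `|y| ^+ size s <= `|\prod_(z <- s) z|.
Proof.
case: s => // z s _; elim: s z => [|w s IH] z.
  by exists z; rewrite ?mem_head // big_seq1 expr1.
have [y ys yle] := IH w; rewrite big_cons normrM.
have /orP[zy|yz] : (`|z| <= `|y|) || (`|y| <= `|z|).
  by apply: real_leVge; apply: normr_real.
- exists z; rewrite ?mem_head // [size _]/= exprS ler_wpM2l //.
  by apply: le_trans yle; rewrite lerXn2r // nnegrE.
- exists y; first by rewrite in_cons ys orbT.
  by rewrite [size _]/= exprS ler_pM // exprn_ge0.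
Qed.

(** Synthetic division recovers the coefficients of the quotient from the top down, each from the
    next higher one; the recursion starts at degree [n], where they are 0. *)
Lemma coef_cvg_deflate (y : T -> K) (x : K) (Q : T -> {poly K}) (q : {poly K}) n :
  (y t : K^o) @[t --> F] --> (x : K^o) ->
  (forall t, size (Q t) <= n)%N -> (size q <= n)%N ->
  coef_cvg (fun t => ('X - (y t)%:P) * Q t) (('X - x%:P) * q) ->
  coef_cvg Q q.
Proof.
move=> yx szQ szq PQ.
have coefE (a : K) (P : {poly K}) k :
    P`_k = (('X - a%:P) * P)`_k.+1 + a * P`_k.+1.
  by rewrite mulrBl coefB coefXM coefCM /= subrK.
suff H m k : (n <= k + m)%N -> ((Q t)`_k : K^o) @[t --> F] --> (q`_k : K^o).
  by move=> k; apply: (H n); rewrite leq_addl.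
elim: m k => [|m IH] k nk.
  rewrite addn0 in nk; rewrite nth_default ?(leq_trans szq) //.
  under eq_fun do rewrite nth_default ?(leq_trans (szQ _)) //.
  exact: cvg_cst.
rewrite (coefE x); under eq_fun => t do rewrite (coefE (y t)).
apply: cvgD; first exact: PQ.
by apply: cvgM => //; apply: IH; rewrite addSnnS.
Qed.

Lemma cvg_horner_coef (P : T -> {poly K}) (p : {poly K}) n x :
  (forall t, size (P t) <= n)%N -> (size p <= n)%N ->
  coef_cvg P p -> ((P t).[x] : K^o) @[t --> F] --> (p.[x] : K^o).
Proof.
move=> szP szp Pp; rewrite (horner_coef_wide _ szp).
under eq_fun do rewrite (horner_coef_wide _ (szP _)).
apply: cvg_sumr => i; apply: cvgM; [exact: Pp|exact: cvg_cst].
Qed.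

(** The root nearest to [x] works: a power of its distance to [x] is at most the norm of the value
    at [x], which tends to the limit value 0. *)
Lemma cvg_nearest_root (b : T -> seq K) (x : K) (a : seq K) :
  (forall t, size (b t) = (size a).+1) ->
  coef_cvg (fun t => \prod_(z <- b t) ('X - z%:P))
           (\prod_(z <- x :: a) ('X - z%:P)) ->
  exists2 y : T -> K, (forall t, y t \in b t) &
    (y t : K^o) @[t --> F] --> (x : K^o).
Proof.
move=> szb cb.
have near_root t : exists y, y \in b t /\
    `|x - y| ^+ (size a).+1 <= `|(\prod_(z <- b t) ('X - z%:P)).[x]|.
  have [|w /mapP[y yb ->] le_w] := @min_norm_prod [seq x - z | z <- b t].
    by rewrite -size_eq0 size_map szb.
  exists y; split=> //; move: le_w; rewrite size_map szb big_map horner_prod.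
  by under [in X in _ -> X]eq_bigr do rewrite hornerXsubC.
have [y yP] := choice near_root; exists y => [t|]; first by have [] := yP t.
have px : (\prod_(z <- b t) ('X - z%:P)).[x] @[t --> F] --> (0 : K^o).
  have <- : (\prod_(z <- x :: a) ('X - z%:P)).[x] = 0.
    by rewrite horner_prod big_cons hornerXsubC subrr mul0r.
  apply: (@cvg_horner_coef _ _ (size a).+2) => // [t|].
    by rewrite size_prod_XsubC szb.
  by rewrite size_prod_XsubC.
apply/cvgrPdist_lt => e e0.
have en0 : 0 < e ^+ (size a).+1 by rewrite exprn_gt0.
near=> t.
rewrite -(@ltr_pXn2r _ (size a).+1) ?nnegrE ?(ltW e0) //.
apply: le_lt_trans (yP t).2 _; near: t.
exact: (cvgr0_norm_lt _ px).
Unshelve. all: by end_near. Qed.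

(* By induction on the limit roots: some root of the t-th polynomial tends to x,
   and dividing by the corresponding linear factors preserves the convergence of
   the coefficients. *)
Lemma cvg_sum_roots (R : numFieldType) (f : K^o -> R^o) (b : T -> seq K) (a : seq K) :
  continuous f -> (forall t, size (b t) = size a) ->
  coef_cvg (fun t => \prod_(z <- b t) ('X - z%:P)) (\prod_(z <- a) ('X - z%:P)) ->
  \sum_(z <- b t) f z @[t --> F] --> \sum_(z <- a) f z.
Proof.
move=> cf; elim: a b => [|x a IH] b szb cb.
  have b0 t : b t = [::] by apply: size0nil; rewrite szb.
  under eq_fun do rewrite b0 big_nil.
  by rewrite big_nil; exact: cvg_cst.
have [y yb yx] := cvg_nearest_root szb cb.
have pb t := perm_to_rem (yb t).
under eq_fun => t do rewrite (perm_big _ (pb t)) big_cons.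
rewrite big_cons; apply: cvgD.
  by apply: cvg_comp yx _; exact: cf.
have szr t : size (rem (y t) (b t)) = size a by rewrite size_rem // szb.
apply: IH => //.
apply: (@coef_cvg_deflate y x _ _ (size a).+1 yx).
- by move=> t; rewrite size_prod_XsubC szr.
- by rewrite size_prod_XsubC.
move=> k; have := cb k; rewrite big_cons.
by under eq_fun => t do rewrite (perm_big _ (pb t)) big_cons.
Qed.

End RootConvergence.

(** * Sums over the spectrum as functions of mu *)

Section EigenvalueSums.
Context {R : realType}.

Lemma cvg_real_complex {T : Type} {F : set_system T} {FF : Filter F}
    (f : T -> R) (a : R) :
  f t @[t --> F] --> a -> ((f t)%:C : R[i]^o) @[t --> F] --> (a%:C : R[i]^o).
Proof.
(* In the order on complex numbers, a positive [e] has zero imaginary part. *)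
move=> fa; apply/cvgrPdist_lt => e; rewrite ltcE /= => /andP[/eqP ei e0].
have eE : e = (complex.Re e)%:C by case: (e) ei => x y /= ->.
near=> t; rewrite -rmorphB /= normc_def /= expr0n /= addr0 sqrtr_sqr eE ltcR.
near: t; apply: cvgr_dist_lt => //.
Unshelve. all: by end_near. Qed.

(** The coefficients of the characteristic polynomial are continuous in the entries, and a sum over
    all roots ignores their labelling. *)
Lemma cvg_sum_eigenvalues {T : Type} {F : set_system T} {FF : Filter F} n
    (M : T -> 'M[R]_n) (M0 : 'M[R]_n) (f : R[i]^o -> R^o) :
  continuous f ->
  (forall i j, (M t i j : R^o) @[t --> F] --> (M0 i j : R^o)) ->
  \sum_(z <- eigenvalues (complex_mx (M t))) f z @[t --> F] -->
  \sum_(z <- eigenvalues (complex_mx M0)) f z.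
Proof.
move=> cf MM; pose b t := eigenvalues (complex_mx (M t)).
have szb t : size (b t) = size (eigenvalues (complex_mx M0)) :=
  etrans (size_eigenvalues _) (esym (size_eigenvalues _)).
apply: (cvg_sum_roots cf szb); rewrite /b.
under eq_fun do rewrite -char_poly_eigenvalues.
rewrite -char_poly_eigenvalues; apply: coef_cvg_char_poly => i j.
by rewrite mxE; under eq_fun do rewrite mxE; apply: cvg_real_complex; exact: MM.
Qed.

Lemma eigenvalues_unitriangular n (M : 'M[R]_n) :
  (forall i j : 'I_n, (j < i)%N -> M i j = 0) -> (forall i, M i i = 1) ->
  perm_eq (eigenvalues (complex_mx M)) (nseq n 1).
Proof.
move=> M0 M1; apply: perm_eigenvalues.
(* Transposition yields the lower triangular form expected by [char_poly_trig]. *)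
have -> : char_poly (complex_mx M) = char_poly (complex_mx M^T).
  rewrite /char_poly -det_tr; congr (\det _); apply/matrixP => i j.
  by rewrite !mxE eq_sym.
rewrite char_poly_trig; last first.
  by apply/is_trig_mxP => i j ij; rewrite !mxE M0.
rewrite big_nseq (eq_bigr (fun=> 'X - 1%:P)) => [|i _]; last by rewrite !mxE M1.
by rewrite prodr_const card_ord iter_mulr_1.
Qed.

Variables (q : nat) (Li Uh : 'M[R]_q).
Hypotheses (Li_unit : Li \in unitmx)
  (Uh_strict : forall i j : 'I_q, (j <= i)%N -> Uh i j = 0)
  (pencil_unit : forall mu : R, 0 < mu -> 1%:M + mu *: Li \in unitmx).
Variables (f : R[i]^o -> R^o) (cf : continuous f).

Definition eigen_sum (mu : R) : R^o :=
  \sum_(z <- eigenvalues (complex_mx (1%:M + error_symbol Li Uh mu))) f z.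

(** The maximum freezes the sum on the negative axis at its value for [mu = 0], which is [f 1 *+ q];
    hence the extension by 0 is continuous. *)
Definition centered_eigen_sum (mu : R) : R^o :=
  eigen_sum (Order.max mu 0) - f 1 *+ q.

Lemma eigen_sum0 : eigen_sum 0 = f 1 *+ q.
Proof.
rewrite /eigen_sum /error_symbol scale0r addr0 invmx1 mul1mx.
rewrite (perm_big _ (eigenvalues_unitriangular _ _)) /=.
- by rewrite big_nseq iter_addr_0.
- by move=> i j ji; rewrite !mxE Uh_strict 1?ltnW // eq_sym -val_eqE ltn_eqF // addr0.
- by move=> i; rewrite !mxE eqxx Uh_strict // addr0.
Qed.

Lemma cvg_eigen_sum {T : Type} {F : set_system T} {FF : Filter F}
    (u : T -> R) (mu : R) :
  0 <= mu -> u t @[t --> F] --> mu -> eigen_sum (u t) @[t --> F] --> eigen_sum mu.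
Proof.
move=> mu0 umu; apply: cvg_sum_eigenvalues => // i j.
rewrite mxE; under eq_fun do rewrite mxE.
apply: cvgD; first exact: cvg_cst.
apply: cvg_mulmx => [{}i {}j|{}i {}j]; last exact: cvg_cst.
apply: cvg_invmx => [{}i {}j|].
  rewrite mxE; under eq_fun do rewrite mxE.
  apply: cvgD; first exact: cvg_cst.
  rewrite mxE; under eq_fun do rewrite mxE.
  by apply: cvgM; [exact: umu|exact: cvg_cst].
(* At [mu = 0] the matrix to be inverted is the identity. *)
move: mu0; rewrite le_eqVlt => /predU1P[<-|/pencil_unit//].
by rewrite scale0r addr0 unitmx1.
Qed.

(* (1 + mu Li)^-1 = mu^-1 (mu^-1 + Li)^-1 *)
Lemma cvg_eigen_sum_pinfty : eigen_sum mu @[mu --> +oo] --> (f 1 *+ q : R^o).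
Proof.
pose I : 'M[R]_q := 1%:M.
rewrite -[X in _ --> X](_ : \sum_(z <- eigenvalues (complex_mx I)) f z = _); last first.
  rewrite (perm_big _ (eigenvalues_unitriangular _ _)) /=.
  - by rewrite big_nseq iter_addr_0.
  - by move=> i j ji; rewrite !mxE eq_sym -val_eqE ltn_eqF.
  - by move=> i; rewrite !mxE eqxx.
apply: cvg_sum_eigenvalues => // i j.
rewrite -[X in _ --> X]addr0; under eq_fun do rewrite mxE.
apply: cvgD; first exact: cvg_cst.
suff H : (mu^-1 * (invmx (mu^-1%:M + Li) *m Uh) i j : R^o) @[mu --> +oo] --> (0 : R^o).
  apply: cvg_trans H; apply: near_eq_cvg; near=> mu.
  have mu_gt0 : 0 < mu by near: mu; exact: nbhs_pinfty_gt.
  have mu0 : mu != 0 by rewrite gt_eqF.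
  rewrite /error_symbol.
  have muE : 1%:M + mu *: Li = mu *: (mu^-1%:M + Li).
    by rewrite scalerDr scale_scalar_mx divff.
  rewrite muE invmxZ -?muE ?pencil_unit //.
  by rewrite -scalemxAl; move: (_ *m Uh) => X; rewrite mxE.
have inv0 : mu^-1 @[mu --> +oo] --> (0 : R^o) 
  by apply/(gtr0_cvgV0 (f := id)); [exact: nbhs_pinfty_gt|exact: cvg_id].
rewrite -[X in _ --> X](mul0r ((invmx Li *m Uh) i j)).
apply: cvgM; first exact: inv0.
apply: cvg_mulmx => [{}i {}j|{}i {}j]; last exact: cvg_cst.
apply: cvg_invmx => // {}i {}j.
rewrite -[X in _ --> X]add0r; under eq_fun do rewrite mxE.
apply: cvgD; last exact: cvg_cst.
rewrite -[X in _ --> X](mul0rn _ (i == j)); under eq_fun do rewrite mxE.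
by apply: cvgMn; exact: inv0.
Unshelve. all: by end_near. Qed.

Lemma continuous_centered_eigen_sum : continuous centered_eigen_sum.
Proof.
move=> mu; apply: cvgB; last exact: cvg_cst.
apply: cvg_eigen_sum; first by rewrite le_max lexx orbT.
by apply: (@continuous_max _ _ id (cst 0)); [exact: cvg_id|exact: cvg_cst].
Qed.

Lemma centered_eigen_sum_le0 mu : mu <= 0 -> centered_eigen_sum mu = 0.
Proof. by move=> mu0; rewrite /centered_eigen_sum max_r // eigen_sum0 subrr. Qed.

Lemma cvg_centered_eigen_sum_pinfty : centered_eigen_sum mu @[mu --> +oo] --> (0 : R^o).
Proof.
rewrite -(subrr (f 1 *+ q)); apply: cvgB; last exact: cvg_cst.
apply: cvg_trans cvg_eigen_sum_pinfty; apply: near_eq_cvg; near=> mu.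
by rewrite max_l //; near: mu; exact: nbhs_pinfty_ge.
Unshelve. all: by end_near. Qed.

End EigenvalueSums.

(** * Test functions *)

Section TestFunctions.
Context {R : realType}.

Lemma continuous_Re : continuous (fun z : R[i]^o => complex.Re z : R^o).
Proof.
move=> z; apply/(@cvgrPdist_lt _ _ _ (nbhs (z : R[i]^o))) => e e0.
have ec0 : (0 : R[i]) < e%:C by rewrite ltcR.
near=> w; rewrite -ltcR; apply: le_lt_trans (_ : `|z - w| < e%:C).
  by rewrite -raddfB; exact: normc_ge_Re.
near: w; apply: (@cvgr_dist_lt _ R[i]^o _ (nbhs (z : R[i]^o)) _ id) => //.
Unshelve. all: by end_near. Qed.

Lemma continuous_Im : continuous (fun z : R[i]^o => complex.Im z : R^o).
Proof.
(* Up to sign the imaginary part of [z] is the real part of [z * 'i], which has the same norm as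
   [z]. *)
have ImE (z : R[i]) : `|complex.Im z|%:C <= `|z|.
  apply: le_trans (_ : `|z * 'i%C| <= _).
    by apply: le_trans (normc_ge_Re _); case: z => x y; simpc; rewrite /= normrN.
  rewrite normrM [X in _ * X](_ : _ = 1) ?mulr1 //.
  by rewrite normc_def /= expr0n expr1n add0r sqrtr1.
move=> z; apply/(@cvgrPdist_lt _ _ _ (nbhs (z : R[i]^o))) => e e0.
have ec0 : (0 : R[i]) < e%:C by rewrite ltcR.
near=> w; rewrite -ltcR; apply: le_lt_trans (_ : `|z - w| < e%:C).
  by rewrite -raddfB; exact: ImE.
near: w; apply: (@cvgr_dist_lt _ R[i]^o _ (nbhs (z : R[i]^o)) _ id) => //.
Unshelve. all: by end_near. Qed.

Lemma continuous_complex :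
  continuous (fun xy : R^o * R^o => (xy.1%:C + 'i * xy.2%:C : R[i]^o)).
Proof.
move=> [x y]; apply: cvgD; first by apply: cvg_real_complex; exact: cvg_fst.
apply: cvgM; first exact: cvg_cst.
by apply: cvg_real_complex; exact: cvg_snd.
Qed.

(** Test functions live on the complex plane, whereas the spectrum of [Z] is real. The tent in the
    imaginary direction keeps the values of [h] on the real axis and the support bounded. *)
Definition strip_extension (h : R -> R) (z : R[i]^o) : R^o :=
  h (complex.Re z) * Order.max 0 (1 - `|complex.Im z|).

Lemma strip_extension_real h x : strip_extension h x%:C = h x.
Proof. by rewrite /strip_extension /= normr0 subr0 max_r ?ler01 // mulr1. Qed.

Lemma continuous_strip_extension (h : R -> R) : continuous h ->
  continuous (strip_extension h).
Proof.
move=> ch z.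
have cvgRe : complex.Re w @[w --> (z : R[i]^o)] --> (complex.Re z : R^o).
  exact: continuous_Re.
have cvgIm : complex.Im w @[w --> (z : R[i]^o)] --> (complex.Im z : R^o).
  exact: continuous_Im.
have cvgh : h (complex.Re w) @[w --> (z : R[i]^o)] --> (h (complex.Re z) : R^o).
  exact: (cvg_comp _ _ cvgRe (ch _)).
have tent : continuous (fun y : R^o => Order.max 0 (1 - `|y|) : R^o).
  move=> y; apply: (@continuous_max _ _ (cst 0) (fun y : R^o => 1 - `|y|)).
    exact: cvg_cst.
  by apply: cvgB; [exact: cvg_cst|exact: norm_continuous].
have cvgm := cvg_comp _ _ cvgIm (tent _).
exact: cvgM cvgh cvgm.
Qed.

Lemma compact_strip_extension (h : R -> R) (B : R) :
  (forall x, h x != 0 -> `|x| <= B) ->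
  compact (closure [set z | strip_extension h z != 0]).
Proof.
move=> hB.
pose S : set (R^o * R^o) := `[- B, B] `*` `[-1, 1].
pose phi := fun xy : R^o * R^o => (xy.1%:C + 'i * xy.2%:C : R[i]^o).
have cS : compact (phi @` S).
  apply: continuous_compact; first exact/continuous_subspaceT/continuous_complex.
  by apply: compact_setX; exact: segment_compact.
have clS : closed (phi @` S) by apply: compact_closed.
apply: (subclosed_compact _ cS); first exact: closed_closure.
move/closure_id : clS => ->; apply: closureS => z /=.
rewrite /strip_extension mulf_eq0 negb_or => /andP[/hB zB imz].
exists (complex.Re z, complex.Im z); last by rewrite /phi /= [RHS]complexE.
split; rewrite /= in_itv /= -ler_norml //.
by rewrite leNgt; apply: contra imz => i1; rewrite max_l // subr_le0 ltW.
Qed.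

End TestFunctions.

(** * Approximation of functions vanishing at infinity *)

Section VanishingAtInfinity.
Context {R : realType} (H : R -> R).
Hypotheses (H_cont : continuous H) (H_le0 : forall x, x <= 0 -> H x = 0)
  (H_pinfty : H x @[x --> +oo] --> 0).

Lemma vanishing_small (e : R) : 0 < e ->
  exists2 B, 0 <= B & forall x, e <= `|H x| -> 0 <= x <= B.
Proof.
move=> e0; have [B [_ HB]] := cvgr0_norm_lt _ H_pinfty e e0.
exists (Order.max 0 B) => [|x ex]; first by rewrite le_max lexx.
apply/andP; split.
  by rewrite leNgt; apply: contraL ex => /ltW /H_le0 ->; rewrite normr0 -ltNge.
rewrite leNgt; apply: contraL ex; rewrite gt_max => /andP[_ /HB].
by rewrite -ltNge.
Qed.

Lemma vanishing_bounded : exists C : R, forall x, `|H x| <= C.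
Proof.
have [B B0 HB] := vanishing_small ltr01.
have [|c _ Hc] := @EVT_max R (fun x => `|H x|) 0 B B0.
  by apply: continuous_subspaceT => x; apply: cvg_norm; exact: H_cont.
exists (Order.max 1 `|H c|) => x; rewrite le_max; apply/orP.
have [x1|/ltW x1] := leP `|H x| 1; first by left.
by right; apply: Hc; rewrite in_itv /= HB.
Qed.

(** Subtracting the truncation of [H] to [[-e, e]] keeps continuity, moves values by at most [e],
    and gives 0 wherever [H] has norm below [e], hence outside a bounded set. *)
Definition soft_threshold (e x : R) := H x - Order.max (- e) (Order.min e (H x)).

Lemma continuous_soft_threshold e : continuous (soft_threshold e).
Proof.
move=> x; apply: cvgB; first exact: H_cont.
apply: (@continuous_max _ _ (cst (- e)) (fun x => Order.min e (H x))).
  exact: cvg_cst.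
apply: (@continuous_min _ _ (cst e) H); first exact: cvg_cst.
exact: H_cont.
Qed.

Lemma soft_threshold_close e x : 0 < e -> `|H x - soft_threshold e x| <= e.
Proof.
move=> e0; rewrite /soft_threshold opprB addrC subrK ler_norml.
by rewrite ge_max le_max lexx ge_min lexx /= andbT; lra.
Qed.

Lemma soft_threshold_support e : 0 < e ->
  exists B, forall x, soft_threshold e x != 0 -> `|x| <= B.
Proof.
move=> /[dup] e0 /vanishing_small[B B0 HB]; exists B => x.
have [/HB/andP[x0 xB]|] := leP e `|H x|; first by rewrite ger0_norm.
rewrite ltr_norml /soft_threshold => /andP[h1 h2].
by rewrite min_r ?max_r ?subrr ?eqxx // ltW.
Qed.

End VanishingAtInfinity.

(** * Extension of the class of test functions *)

Section SpectralDistribution.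
Context {R : realType} (m : nat) (D : set (m.-tuple (measurableTypeR R)))
  (s : m.-tuple (measurableTypeR R) -> R).
Hypotheses (mD : measurable D) (hD : (0 < lebesgueRm m D < +oo)%E)
  (ms : measurable_fun D s).

Let volD := fine (lebesgueRm m D).

Lemma volD_gt0 : 0 < volD.
Proof. by rewrite fine_gt0. Qed.

Lemma eigenvalues_scalar1 (a : R[i]) : eigenvalues (a%:M : 'M[R[i]]_1) = [:: a].
Proof.
apply/perm_small_eq => //.
apply: perm_eigenvalues; rewrite big_seq1 /char_poly det_mx11 !mxE.
by rewrite eqxx mulr1n.
Qed.

Lemma integrable_comp_bounded (H : R -> R) : continuous H ->
  (exists C, forall x, `|H x| <= C) ->
  (lebesgueRm m).-integrable D (EFin \o (H \o s)).
Proof.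
move=> cH [C HC]; apply: measurable_bounded_integrable => //.
- by case/andP: hD.
- by apply: measurableT_comp => //; exact: measurable_realfun.continuous_measurable_fun.
exists C; split; first exact: num_real.
by move=> C' CC' x _ /=; rewrite (le_trans (HC _)) // ltW.
Qed.

(** The hypothesis is used for the soft threshold of [H] at [e / 3]. The average over the spectrum
    and the one over [D] each change by at most [e / 3], which leaves [e / 3] for the convergence
    itself. *)
Lemma spectrally_distributed_C0 (d : nat -> nat) (X : forall n, 'M[R[i]]_(d n))
    (r : nat -> seq R) (H : R -> R) :
  (forall n, eigenvalues (X n) = [seq x%:C | x <- r n]) ->
  spectrally_distributed D X (fun x => (s x)%:C%:M : 'M[R[i]]_1) ->
  continuous H -> (forall x, x <= 0 -> H x = 0) -> H x @[x --> +oo] --> 0 ->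
  (d n)%:R^-1 * \sum_(x <- r n) H x @[n --> \oo] -->
    (volD^-1 * \int[lebesgueRm m]_(x in D) H (s x) : R^o).
Proof.
move=> eigX distX cH H0 Hoo.
have bH := vanishing_bounded cH H0 Hoo.
apply/cvgrPdist_le => e e0; pose e3 := e / 3.
have e30 : 0 < e3 by rewrite divr_gt0.
pose h := soft_threshold H e3.
have ch : continuous h by exact: continuous_soft_threshold.
have [B hB] := soft_threshold_support H0 Hoo e30.
have [_ cvgh] := distX _ (continuous_strip_extension ch) (compact_strip_extension hB).
have bh : exists C, forall x, `|h x| <= C.
  have [C HC] := bH; exists (C + e3) => x.
  have := soft_threshold_close H x e30; rewrite -/(h x) distrC => hx.
  rewrite -[h x](subrK (H x)) (le_trans (ler_normD _ _)) // addrC lerD //.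
have close_r n : `|(d n)%:R^-1 * \sum_(x <- r n) H x -
                   (d n)%:R^-1 * \sum_(x <- r n) h x| <= e3.
  rewrite -mulrBr -sumrB normrM ger0_norm ?invr_ge0 ?ler0n //.
  have szr : size (r n) = d n by rewrite -(size_eigenvalues (X n)) eigX size_map.
  (* For an empty matrix the normalizing factor is the inverse of 0, that is 0. *)
  have [d0|d0] := posnP (d n); first by rewrite d0 invr0 mul0r ltW.
  rewrite ler_pdivrMl ?ltr0n // (le_trans (ler_norm_sum _ _ _)) //.
  apply: (@le_trans _ _ (\sum_(x <- r n) e3)).
    by apply: ler_sum => x _; exact: soft_threshold_close.
  by rewrite big_const_seq count_predT szr iter_addr_0 mulr_natl.
have close_i : `|volD^-1 * \int[lebesgueRm m]_(x in D) H (s x) -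
                 volD^-1 * \int[lebesgueRm m]_(x in D) h (s x)| <= e3.
  have iH := integrable_comp_bounded cH bH.
  have ih := integrable_comp_bounded ch bh.
  rewrite -mulrBr -RintegralB // normrM ger0_norm ?invr_ge0 ?(ltW volD_gt0) //.
  rewrite ler_pdivrMl ?volD_gt0 //.
  pose g x := H x - h x.
  have cg : continuous g by move=> x; apply: cvgB; [exact: cH|exact: ch].
  have gle x : `|g x| <= e3 by exact: soft_threshold_close.
  have ig := integrable_comp_bounded cg (ex_intro _ e3 gle).
  apply: le_trans (le_normr_Rintegral mD ig) _.
  apply: (@le_trans _ _ (\int[lebesgueRm m]_(x in D) e3)).
    apply: le_Rintegral => //.
    - apply: (@integrable_comp_bounded (fun x => `|g x|)).
        by move=> x; apply: cvg_norm; exact: cg.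
      by exists e3 => x; rewrite normr_id.
    - apply: (@integrable_comp_bounded (cst e3)); first exact: cst_continuous.
      by exists `|e3|.
    by move=> x _; exact: gle.
  by rewrite Rintegral_cst // mulrC.
have intE : \int[lebesgueRm m]_(x in D)
      (1^-1 * \sum_(z <- eigenvalues ((s x)%:C%:M : 'M[R[i]]_1)) strip_extension h z) =
    \int[lebesgueRm m]_(x in D) h (s x).
  apply: eq_Rintegral => x _.
  by rewrite eigenvalues_scalar1 big_seq1 invr1 mul1r strip_extension_real.
rewrite intE in cvgh.
near=> n.
have sumE : \sum_(z <- eigenvalues (X n)) strip_extension h z = \sum_(x <- r n) h x.
  by rewrite eigX big_map; apply: eq_bigr => x _; exact: strip_extension_real.
have cn : `|volD^-1 * \int[lebesgueRm m]_(x in D) h (s x) -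
            (d n)%:R^-1 * \sum_(x <- r n) h x| <= e3.
  by rewrite -sumE; near: n; apply: cvgr_dist_le.
have := close_r n; rewrite distrC => cr.
set a := _ * \int[_]_(_ in D) H _ in close_i *.
set a' := _ * \int[_]_(_ in D) h _ in close_i cn *.
set b := _ * \sum_(_ <- _) H _ in cr *; set b' := _ * \sum_(_ <- _) h _ in cr cn.
have -> : a - b = (a - a') + (a' - b') + (b' - b) by lra.
rewrite (le_trans (ler_normD _ _)) // (le_trans (lerD (ler_normD _ _) (lexx _))) //.
have -> : e = e3 + e3 + e3 by rewrite /e3; lra.
by rewrite !lerD.
Unshelve. all: by end_near. Qed.

End SpectralDistribution.

(* The number of stages is q = p.+2, i.e. any q >= 2. *)
Theorem theorem4 (R : realType) (p : nat) (c : 'I_p.+2 -> R) (L U : 'M[R]_p.+2)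
    (M K : forall n : nat, 'M[R]_(n ^ 2)) (tau : nat -> R)
    (m : nat) (D : set (m.-tuple (measurableTypeR R)))
    (s : m.-tuple (measurableTypeR R) -> R)
    (lam : 'I_p.+1 -> R -> R[i])
    (hc : radau_nodes c)
    (hLU : LU_factorization (invmx (radau_mx c)) L U)
    (hM : forall n, sym_posdef (M n))
    (hK : forall n, sym_posdef (K n))
    (htau : forall n, 0 < tau n)
    (mD : measurable D)
    (hD : (0 < lebesgueRm m D < +oo)%E)
    (ms : measurable_fun D s)
    (hlam : forall mu, 0 < mu ->
       branch_values (U - 1%:M) (invmx L) mu (fun k => lam k mu))
    (hZ : spectrally_distributed D
            (fun n => complex_mx (Ztau (M n) (K n) (tau n)))
            (fun x => ((s x)%:C)%:M : 'M[R[i]]_1)) :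
  spectrally_distributed D
    (fun n => complex_mx (invmx (precond_mx L (M n) (K n) (tau n))
                          *m stage_mx (radau_mx c) (M n) (K n) (tau n)))
    (fun x => branch_symbol lam (s x)).
Proof.
move=> F cF kF.
have Lu := L_unit hc hLU.
have Uz := unitriangular_sub1 hLU.
have Eb mu (mu0 : 0 < mu) := eigenvalues_branch hc hLU mu0 (hlam mu mu0).
have Eu mu (mu0 : 0 < mu) := (Eb mu mu0).1.
have Liu : invmx L \in unitmx by rewrite unitmx_inv.
pose H := centered_eigen_sum (invmx L) (U - 1%:M) F.
have cH : continuous H by exact: continuous_centered_eigen_sum.
have H0 x : x <= 0 -> H x = 0 by exact: centered_eigen_sum_le0.
have Hoo : H x @[x --> +oo] --> 0 by exact: cvg_centered_eigen_sum_pinfty.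
have HE mu : 0 < mu ->
    eigen_sum (invmx L) (U - 1%:M) F mu = H mu + F 1 *+ p.+2.
  by move=> mu0; rewrite /H /centered_eigen_sum max_l ?(ltW mu0) // subrK.
(* For [mu <= 0] the symbol is the identity and [H] vanishes, so the formula holds on the whole
   line. *)
have symE mu : \sum_(z <- eigenvalues (branch_symbol lam mu)) F z = H mu + F 1 *+ p.+2.
  rewrite (perm_big _ (eigenvalues_branch_symbol lam mu)) /=.
  have [mu0|mu0] := ltP 0 mu.
    by rewrite -HE // /eigen_sum (perm_big _ (Eb mu mu0).2).
  rewrite H0 // add0r big_cons big_map mulrS; congr (_ + _).
  under eq_bigr do rewrite addr0.
  by rewrite big_const_seq count_predT size_enum_ord iter_addr_0.
have ex_r n : exists r : seq R, all (> 0) r /\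
    eigenvalues (complex_mx (Ztau (M n) (K n) (tau n))) = [seq x%:C | x <- r].
  by have [r r0 rE] := eigenvalues_Ztau (hM n) (hK n) (htau n); exists r.
have [r rP] := choice ex_r.
have rE n := (rP n).2.
have r0 n x : x \in r n -> 0 < x by move=> xr; exact: (allP (rP n).1).
have szr n : size (r n) = (n ^ 2)%N.
  by rewrite -(size_eigenvalues (complex_mx (Ztau (M n) (K n) (tau n)))) rE size_map.
have bH := vanishing_bounded cH H0 Hoo.
have iH := integrable_comp_bounded mD hD ms cH bH.
have v0 := volD_gt0 hD.
split.
  under eq_fun do rewrite symE.
  apply: (@measurableT_comp _ _ _ _ _ _ (fun mu => H mu + F 1 *+ p.+2)) => //.
  apply: measurable_realfun.continuous_measurable_fun => x.
  by apply: cvgD; [exact: cH|exact: cvg_cst].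
(* The constant [F 1 *+ p.+2] integrates to itself times the volume of [D]; both normalizations
   cancel and leave [F 1]. *)
have intE : (fine (lebesgueRm m D))^-1 * \int[lebesgueRm m]_(x in D)
    (p.+2%:R^-1 * \sum_(z <- eigenvalues (branch_symbol lam (s x))) F z) =
  p.+2%:R^-1 * ((fine (lebesgueRm m D))^-1 * \int[lebesgueRm m]_(x in D) H (s x)) + F 1.
  under eq_Rintegral do rewrite symE.
  have icst : (lebesgueRm m).-integrable D (EFin \o cst (F 1 *+ p.+2)).
    apply: (@integrable_comp_bounded _ _ _ s mD hD ms (cst (F 1 *+ p.+2))).
      exact: cst_continuous.
    by exists `|F 1 *+ p.+2|.
  have iHc : (lebesgueRm m).-integrable D (EFin \o (fun x => H (s x) + F 1 *+ p.+2)).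
    apply: (@integrable_comp_bounded _ _ _ s mD hD ms (fun y => H y + F 1 *+ p.+2)).
      by move=> x; apply: cvgD; [exact: cH|exact: cvg_cst].
    have [C HC] := bH; exists (C + `|F 1 *+ p.+2|) => x.
    by rewrite (le_trans (ler_normD _ _)) // lerD.
  rewrite RintegralZl // RintegralD // Rintegral_cst // -mulr_natr.
  by field; rewrite (gt_eqF v0) -natrD pnatr_eq0.
rewrite intE.
(* Each of the [n ^ 2] eigenvalues [x] of [Z] contributes [H x] plus [q] copies of [F 1]. *)
have sumE n :
    \sum_(z <- eigenvalues (complex_mx (invmx (precond_mx L (M n) (K n) (tau n))
      *m stage_mx (radau_mx c) (M n) (K n) (tau n)))) F z =
    \sum_(x <- r n) H x + F 1 *+ (p.+2 * n ^ 2).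
  have [_ _ _ AE] := hLU.
  rewrite (perm_big _ (eigenvalues_precond (hM n) Lu AE _ (rE n))) /=; last first.
    by move=> x /r0/Eu.
  rewrite big_flatten /= big_map mulrnA -[in RHS](szr n).
  rewrite -(count_predT (r n)) -(iter_addr_0 (count _ _)) -big_const_seq -big_split /=.
  by rewrite !big_seq; apply: eq_bigr => x /r0 x0; rewrite -HE.
under eq_fun do rewrite sumE.
have cvgH := spectrally_distributed_C0 mD hD ms rE hZ cH H0 Hoo.
have cvgq : p.+2%:R^-1 * ((n ^ 2)%:R^-1 * \sum_(x <- r n) H x) + F 1 @[n --> \oo] -->
    (p.+2%:R^-1 * ((fine (lebesgueRm m D))^-1 *
      \int[lebesgueRm m]_(x in D) H (s x)) + F 1 : R^o).
  by apply: cvgD; [apply: cvgM => //; exact: cvg_cst|exact: cvg_cst].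
(* The constant part averages to [F 1] only for [n > 0]; at [n = 0] the normalizing factor is 0. *)
apply: cvg_trans cvgq; apply: near_eq_cvg; near=> n.
have n0 : (0 < n)%N by near: n; exact: nbhs_infty_gt.
rewrite /= natrM -[F 1 *+ _]mulr_natr natrM.
by field; rewrite pnatr_eq0 -lt0n n0 -natrD pnatr_eq0.
Unshelve. all: by end_near. Qed.
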